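(* Let $\mathcal{H}$ be a $d$-dimensional Hilbert space, $\rho=\rho(\theta)\in\mathscr{D}(\mathcal{H})$, and let $\mathscr{A}$ be a POVM on $\mathcal{H}$. Then $$\mu(\mathcal{F}_{\mathrm S}(\rho,\mathscr{A}))=\gamma(\mathscr{A}),$$ $$\zeta_\rho(\mathscr{A})=\mu(I_{\mathrm S}(\theta,\mathscr{A}))=\mu(\bar{\mathcal{F}}_{\mathrm S}(\rho,\mathscr{A}))=\gamma(\mathscr{A})-1.$$ The same conclusions hold if $\mathcal{F}_{\mathrm S}$ is replaced by $\mathcal{F}_{\mathrm L}$ or $\mathcal{F}_{\mathrm R}$, and $\bar{\mathcal{F}}_{\mathrm S}$ (respectively $I_{\mathrm S}$) is replaced by $\bar{\mathcal{F}}_{\mathrm L}$ (respectively $I_{\mathrm R}$) or $\bar{\mathcal{F}}_{\mathrm R}$ (respectively $I_{\mathrm L}$) accordingly; that is, $$\mu(\mathcal{F}_{\mathrm L}(\rho,\mathscr{A}))=\gamma(\mathscr{A}),\qquad \zeta_\rho(\mathscr{A})=\mu(I_{\mathrm R}(\theta,\mathscr{A}))=\mu(\bar{\mathcal{F}}_{\mathrm L}(\rho,\mathscr{A}))=\gamma(\mathscr{A})-1,$$ $$\mu(\mathcal{F}_{\mathrm R}(\rho,\mathscr{A}))=\gamma(\mathscr{A}),\qquad \zeta_\rho(\mathscr{A})=\mu(I_{\mathrm L}(\theta,\mathscr{A}))=\mu(\bar{\mathcal{F}}_{\mathrm R}(\rho,\mathscr{A}))=\gamma(\mathscr{A})-1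.$$
   Context: $\mathcal{H}$ is a complex Hilbert space of finite dimension $d$; $\mathscr{D}(\mathcal{H})$ is the set of positive definite operators of trace 1 on $\mathcal{H}$. For an operator, matrix or superoperator $\Theta$, $\mu(\Theta)$ is the algebraic multiplicity of the eigenvalue $1$ of $\Theta$ (0 if 1 is not an eigenvalue). POVMs. A POVM on $\mathcal{H}$ is a finite family of positive semidefinite operators on $\mathcal{H}$ summing to the identity. The transition graph $G(\mathscr{A})$ of a POVM $\mathscr{A}$ has one vertex for each nonzero element, two vertices being adjacent iff the corresponding elements are not orthogonal (Hilbert–Schmidt inner product nonzero, equivalently product nonzero). The elements belonging to a connected component of $G(\mathscr{A})$ form an irreducible component. The projective index $\gamma(\mathscr{A})$ is the number of irreducible components. Fisher information matrices. $\rho(\theta)\in\mathscr{D}(\mathcal{H})$ is a parametrization by $g=d^2-1$ real parameters $\theta$, differentiable and with linearly independent derivatives $\rho_{,a}:=\partial\rho(\theta)/\partial\theta_a$ (a basis of the real space of traceless Hermitian operators). For $\mathscr{A}=\{A_j\}_j$ put $p_j=\operatorname{tr}[\rho(\theta)A_j]$; $I(\theta,\mathscr{A})$ has entries $I_{ab}=\sum_{j:A_j\neq0}\frac{1}{p_j}\frac{\partial p_j}{\partial\theta_a}\frac{\partial p_j}{\partial\theta_b}$. $J_{\mathrm S}$ has entries $\frac12\operatorname{tr}[\rho(L_aL_b+L_bL_a)]$ with $L_a$ the Hermitian solution of $\frac12(\rho L_a+L_a\rho)=\rho_{,a}$; $J_{\mathrm R}$ (right logarithmic derivative) is the Hermitian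 matrix with entries $\operatorname{tr}(\rho_{,a}\rho^{-1}\rho_{,b})$; $J_{\mathrm L}$ (left logarithmic derivative) is the Hermitian matrix with entries $\operatorname{tr}(\rho_{,a}\rho_{,b}\rho^{-1})$. For $X\in\{\mathrm S,\mathrm L,\mathrm R\}$, $I_X(\theta,\mathscr{A}):=J_X^{-1/2}I(\theta,\mathscr{A})J_X^{-1/2}$. The sharpness index $\zeta_\rho(\mathscr{A})$ is the multiplicity of the eigenvalue 1 of $I_{\mathrm S}(\theta,\mathscr{A})$ at $\rho=\rho(\theta)$. Superoperators. The operators on $\mathcal{H}$ form a Hilbert space with inner product $\langle\!\langle A|B\rangle\!\rangle=\operatorname{tr}(A^\dagger B)$; $|A\rangle\!\rangle$ denotes $A$ as a vector, and superoperators are linear maps on this space. $\bar{\mathbf I}$ is the orthogonal projector onto traceless operators. $\mathcal{F}(\rho,\mathscr{A}):=\sum_{j:A_j\neq0}\frac{|A_j\rangle\!\rangle\langle\!\langle A_j|}{\operatorname{tr}(\rho A_j)}$ and $\bar{\mathcal{F}}:=\bar{\mathbf I}\mathcal{F}\bar{\mathbf I}$. $\mathcal{L}|A\rangle\!\rangle=|\rho A\rangle\!\rangle$, $\mathcal{R}|A\rangle\!\rangle=|A\rho\rangle\!\rangle$, $\mathcal{S}=(\mathcal{L}+\mathcal{R})/2$; $\mathcal{J}_{\mathrm L}=\mathcal{L}^{-1}$, $\mathcal{J}_{\mathrm R}=\mathcal{R}^{-1}$, $\mathcal{J}_{\mathrm S}=\mathcal{S}^{-1}$, and $\bar{\mathcal{J}}_X=\bar{\mathbf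 I}\mathcal{J}_X\bar{\mathbf I}$. For $X\in\{\mathrm S,\mathrm L,\mathrm R\}$, $\mathcal{F}_X:=\mathcal{J}_X^{-1/2}\mathcal{F}\mathcal{J}_X^{-1/2}$ and $\bar{\mathcal{F}}_X:=(\bar{\mathcal{J}}_X^{+})^{1/2}\bar{\mathcal{F}}(\bar{\mathcal{J}}_X^{+})^{1/2}$, where $^+$ is the Moore–Penrose inverse. *)

(* Defs.v *)
From HB Require Import structures.
From mathcomp Require Import all_boot all_order all_algebra.
From mathcomp Require Import sesquilinear spectral.
From mathcomp Require Import complex.
From mathcomp Require Import all_classical all_reals all_analysis.

Set Implicit Arguments.
Unset Strict Implicit.
Unset Printing Implicit Defensive.

Import Order.TTheory GRing.Theory Num.Theory.
Import numFieldNormedType.Exports.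

Local Open Scope classical_set_scope.
Local Open Scope ring_scope.
Local Open Scope sesquilinear_scope.

Section Matrices.
Context {C : numClosedFieldType}.

(* Algebraic multiplicity of the eigenvalue 1; it is 0 when 1 is not a root of
   the characteristic polynomial. *)
Definition mu n (M : 'M[C]_n) : nat := mup 1 (char_poly M).

Definition possemidefmx n (M : 'M[C]_n) : Prop :=
  M \is hermsymmx /\ forall v : 'cV[C]_n, 0 <= (v^t* *m M *m v) 0 0.

Definition posdefmx n (M : 'M[C]_n) : Prop :=
  M \is hermsymmx /\ forall v : 'cV[C]_n, v != 0 -> 0 < (v^t* *m M *m v) 0 0.

(* The square root of a positive semidefinite matrix, by functional calculus;
   only used on such matrices, see [sqrtmx_psd], [sqrtmxK], [sqrtmx_uniq]. *)
Definition sqrtmx n (M : 'M[C]_n) : 'M[C]_n :=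
  invmx (spectralmx M) *m diag_mx (map_mx sqrtC (spectral_diag M))
    *m spectralmx M.

Lemma spectral_hermE n (M : 'M[C]_n) : M \is hermsymmx ->
  M = (spectralmx M)^t* *m diag_mx (spectral_diag M) *m spectralmx M.
Proof.
move=> /hermitian_normalmx/orthomx_spectralP {1}->.
by rewrite invmx_unitary ?spectral_unitarymx.
Qed.

Lemma psd_congr_diag n (P : 'M[C]_n) (D : 'rV[C]_n) :
  (forall i, 0 <= D 0 i) -> possemidefmx (P^t* *m diag_mx D *m P).
Proof.
move=> D0; split.
  rewrite is_hermitianmxE expr0 scale1r; apply/eqP.
  rewrite !trmx_mul !map_mxM trmxCK mulmxA; congr (_ *m _ *m _).
  rewrite tr_diag_mx map_diag_mx; congr diag_mx; apply/rowP => i.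
  by rewrite mxE; apply/esym/CrealP/ger0_real.
move=> v; have -> : v^t* *m (P^t* *m diag_mx D *m P) *m v =
    (P *m v)^t* *m (diag_mx D *m (P *m v)).
  by rewrite trmx_mul map_mxM !mulmxA.
move: (P *m v) => w; rewrite mxE sumr_ge0// => i _.
by rewrite mul_diag_mx !mxE mulrCA mulr_ge0// mulrC mul_conjC_ge0.
Qed.

Lemma psd_spectral_ge0 n (M : 'M[C]_n) :
  possemidefmx M -> forall i, 0 <= spectral_diag M 0 i.
Proof.
move=> [Mh M0] i; set P := spectralmx M.
have PP : P *m P^t* = 1%:M by apply/unitarymxP/spectral_unitarymx.
have := M0 (P^t* *m delta_mx i 0).
rewrite {1}(spectral_hermE Mh) -/P trmx_mul map_mxM trmxCK !mulmxA.
rewrite -[_ *m P *m P^t*]mulmxA PP mulmx1 -[_ *m P *m P^t*]mulmxA PP mulmx1.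
by rewrite trmx_delta map_delta_mx -rowE -colE !mxE eqxx mulr1n.
Qed.

Lemma sqrtmx_psd n (M : 'M[C]_n) : possemidefmx M -> possemidefmx (sqrtmx M).
Proof.
move=> /psd_spectral_ge0 M0.
rewrite /sqrtmx invmx_unitary ?spectral_unitarymx//.
by apply: psd_congr_diag => i; rewrite mxE sqrtC_ge0.
Qed.

Lemma sqrtmxK n (M : 'M[C]_n) :
  possemidefmx M -> sqrtmx M *m sqrtmx M = M.
Proof.
move=> [/hermitian_normalmx/orthomx_spectralP Mh _].
rewrite [RHS]Mh /sqrtmx !mulmxA mulmxK ?spectral_unit//.
congr (_ *m _); rewrite -mulmxA mulmx_diag; congr (_ *m diag_mx _).
by apply/rowP => i; rewrite !mxE -expr2 sqrtCK.
Qed.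

Lemma sqrtmx_uniq n (M S : 'M[C]_n) :
  possemidefmx S -> S *m S = M -> S = sqrtmx M.
Proof.
move=> Spsd SM.
have Mpsd : possemidefmx M.
  have [+ _] := Spsd; rewrite is_hermitianmxE expr0 scale1r => /eqP Sh.
  rewrite -SM {1}Sh.
  have := @psd_congr_diag n S (const_mx 1).
  by rewrite diag_const_mx mulmx1; apply => i; rewrite mxE ler01.
have Tpsd := sqrtmx_psd Mpsd; have TM := sqrtmxK Mpsd.
move: (sqrtmx M) Tpsd TM => T Tpsd; rewrite -{}SM => TS.
have S0 := psd_spectral_ge0 Spsd; have T0 := psd_spectral_ge0 Tpsd.
have SE := spectral_hermE Spsd.1; have TE := spectral_hermE Tpsd.1.
have := spectral_unitarymx S; have := spectral_unitarymx T.
move: (spectralmx S) (spectralmx T) (spectral_diag S) (spectral_diag T)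
  SE TE S0 T0 => P Q D E SE TE D0 E0 /unitarymxP QQ /unitarymxP PP.
have PP' := mulmx1C PP; have QQ' := mulmx1C QQ.
pose W := P *m Q^t*.
have DW : diag_mx D *m W = W *m diag_mx E.
  have : diag_mx D *m diag_mx D *m W = W *m diag_mx E *m diag_mx E.
    have /(congr1 (fun X => P *m X *m Q^t*)) := TS.
    rewrite SE TE /W !mulmxA PP mul1mx -!mulmxA QQ mulmx1.
    by rewrite !(mulmxA P) PP mul1mx !(mulmxA Q) QQ mul1mx => ->.
  move: (W) => {}W /matrixP DDW; apply/matrixP => i j.
  have := DDW i j; rewrite -(mulmxA W) !mulmx_diag !mul_diag_mx !mul_mx_diag.
  rewrite !mxE; have [->|W0] := eqVneq (W i j) 0.
    by rewrite !(mulr0, mul0r).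
  rewrite mulrC => /(mulfI W0).
  rewrite -!expr2 => /eqP; rewrite eqrXn2// => /eqP->.
  by rewrite mulrC.
have SQ : S = P^t* *m (diag_mx D *m W) *m Q.
  by rewrite SE /W !mulmxA -[_ *m Q^t* *m Q]mulmxA QQ' mulmx1.
by rewrite SQ DW /W TE !mulmxA PP' mul1mx.
Qed.

Definition invsqrtmx n (M : 'M[C]_n) : 'M[C]_n := invmx (sqrtmx M).

Definition is_mpinv n (M P : 'M[C]_n) : Prop :=
  [/\ M *m P *m M = M, P *m M *m P = P,
      (M *m P)^t* = M *m P & (P *m M)^t* = P *m M].

(* The Moore-Penrose inverse; see [is_mpinv_uniq] and, for Hermitian matrices,
   [mpinvP]. *)
Definition mpinv n (M : 'M[C]_n) : 'M[C]_n := xget 0 (is_mpinv M).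

Lemma is_mpinv_uniq n (M P Q : 'M[C]_n) :
  is_mpinv M P -> is_mpinv M Q -> P = Q.
Proof.
move=> [MPM PMP MP PM] [MQM QMQ MQ QM].
have MPQ : M *m P = M *m Q.
  rewrite -MP -{1}MQM -[_ *m P]mulmxA.
  by rewrite trmx_mul map_mxM MP MQ !mulmxA MPM.
have PMQ : P *m M = Q *m M.
  rewrite -PM -{1}MQM !mulmxA -[_ *m Q *m M]mulmxA.
  by rewrite trmx_mul map_mxM PM QM -mulmxA [M *m _]mulmxA MPM.
by rewrite -PMP PMQ -mulmxA MPQ mulmxA.
Qed.

Lemma mpinvP n (M : 'M[C]_n) : M \is hermsymmx -> is_mpinv M (mpinv M).
Proof.
move=> Mh; suff [P MP] : exists P, is_mpinv M P by apply: (xgetPex 0); exists P.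
have := spectral_unitarymx M; have := spectral_hermE Mh.
move: (spectralmx M) (spectral_diag M) => P D ME /unitarymxP PP.
pose T (E : 'rV[C]_n) := P^t* *m diag_mx E *m P.
have TM E F : T E *m T F = T (\row_i (E 0 i * F 0 i)).
  by rewrite /T !mulmxA -[_ *m P *m P^t*]mulmxA PP mulmx1
             -[_ *m diag_mx E *m _]mulmxA mulmx_diag.
have TC (E : 'rV[C]_n) : (forall i, 0 <= E 0 i) -> (T E)^t* = T E.
  move=> /(@psd_congr_diag _ P)[+ _].
  by rewrite is_hermitianmxE expr0 scale1r => /eqP.
have VV i : 0 <= D 0 i * (D 0 i)^-1 
  by have [->|/divff->] := eqVneq (D 0 i) 0; rewrite ?mul0r ?ler01.
exists (T (map_mx GRing.inv D)); rewrite ME -/(T D).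
split; rewrite !TM.
- congr T; apply/rowP => i; rewrite !mxE.
  by have [->|D0] := eqVneq (D 0 i) 0; rewrite ?mulr0// divff ?mul1r.
- congr T; apply/rowP => i; rewrite !mxE.
  by have [->|D0] := eqVneq (D 0 i) 0; rewrite ?invr0 ?mulr0// mulVf ?mul1r.
- by rewrite TC// => i; rewrite !mxE.
- by rewrite TC// => i; rewrite !mxE mulrC.
Qed.

Definition hsdot n (A B : 'M[C]_n) : C := \tr (A^t* *m B).

End Matrices.

Section Povm.
Context {C : numClosedFieldType} {d : nat} {I : finType}.
Implicit Type A : I -> 'M[C]_d.

Definition is_povm A : Prop :=
  (forall j, possemidefmx (A j)) /\ \sum_j A j = 1%:M.

(* Only nonzero elements are vertices: a zero element is orthogonal to
   everything, hence is never adjacent to another index, and is discarded in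
   [proj_index]. *)
Definition povm_adj A : rel I :=
  [rel j k | (j != k) && (hsdot (A j) (A k) != 0)].

Definition proj_index A : nat := n_comp (povm_adj A) [pred j | A j != 0].

End Povm.

(* A superoperator [f] is represented by the matrix [lin_mx f] acting on row
   vectors: [mxvec X *m lin_mx f = mxvec (f X)].  The coordinates of [mxvec]
   are orthonormal for the Hilbert-Schmidt product [hsdot], so adjoints are
   conjugate transposes.  Since the action is on the right, a matrix product
   is the composition in the reverse order. *)
Section Superoperators.
Context {C : numClosedFieldType} {d : nat}.
Local Notation superop := 'M[C]_(d * d).
Implicit Types (X rho : 'M[C]_d).

Definition ketbra A B : superop := lin_mx (fun X : 'M[C]_d => hsdot B X *: A).

(* orthogonal projector onto the traceless operators *)
Definition Ibar : superop :=
  lin_mx (fun X : 'M[C]_d => X - (\tr X / d%:R)%:M).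

Definition calL rho : superop := lin_mx (fun X : 'M[C]_d => rho *m X).
Definition calR rho : superop := lin_mx (fun X : 'M[C]_d => X *m rho).
Definition calS rho : superop := 2^-1 *: (calL rho + calR rho).

Definition calJ_L rho : superop := invmx (calL rho).
Definition calJ_R rho : superop := invmx (calR rho).
Definition calJ_S rho : superop := invmx (calS rho).

Definition bar (T : superop) : superop := Ibar *m T *m Ibar.

Context {I : finType}.
Implicit Type A : I -> 'M[C]_d.

Definition calF rho A : superop :=
  \sum_(j | A j != 0) (\tr (rho *m A j))^-1 *: ketbra (A j) (A j).

Definition normalizedF (J : superop) rho A : superop :=
  invsqrtmx J *m calF rho A *m invsqrtmx J.

Definition normalizedFbar (J : superop) rho A : superop :=
  sqrtmx (mpinv (bar J)) *m bar (calF rho A) *m sqrtmx (mpinv (bar J)).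

Definition calF_S rho A := normalizedF (calJ_S rho) rho A.
Definition calF_L rho A := normalizedF (calJ_L rho) rho A.
Definition calF_R rho A := normalizedF (calJ_R rho) rho A.

Definition calFbar_S rho A := normalizedFbar (calJ_S rho) rho A.
Definition calFbar_L rho A := normalizedFbar (calJ_L rho) rho A.
Definition calFbar_R rho A := normalizedFbar (calJ_R rho) rho A.

End Superoperators.

Section Derivatives.
Context {R : realType} {g : nat}.
Local Notation C := R[i].
Local Notation param := 'rV[R]_g.

(* [C] carries no structure of normed space over [R], so complex-valued
   functions of real parameters are handled by real and imaginary parts. *)
Definition cdifferentiable (f : param -> C) (t : param) : Prop :=
  differentiable (fun s => complex.Re (f s)) t /\
  differentiable (fun s => complex.Im (f s)) t.

Definition cpartial (f : param -> C) (a : 'I_g) (t : param) : C :=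
  Complex ('D_(delta_mx 0 a) (fun s => complex.Re (f s)) t)
          ('D_(delta_mx 0 a) (fun s => complex.Im (f s)) t).

Definition mxpartial d (F : param -> 'M[C]_d) (a : 'I_g) (t : param) :
    'M[C]_d :=
  \matrix_(i, j) cpartial (fun s => F s i j) a t.

End Derivatives.

Section Sld.
Context {C : numClosedFieldType} {d : nat}.
Implicit Types r X L : 'M[C]_d.

Definition is_sld r X L : Prop :=
  L \is hermsymmx /\ 2^-1 *: (r *m L + L *m r) = X.

(* The symmetric logarithmic derivative; see [is_sld_uniq] and [sldP]. *)
Definition sld r X : 'M[C]_d := xget 0 (is_sld r X).

Lemma lyapunov_inj r X : posdefmx r -> r *m X + X *m r = 0 -> X = 0.
Proof.
move=> [_ r0] rX.
pose q (Y : 'M[C]_d) j := ((col j Y)^t* *m r *m col j Y) 0 0.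
have q0 Y j : 0 <= q Y j.
  have [Yj|/r0/ltW//] := eqVneq (col j Y) 0.
  by rewrite /q Yj mulmx0 mxE.
have qE Y : \tr (Y^t* *m r *m Y) = \sum_j q Y j.
  apply: eq_bigr => j _; rewrite /q !mxE; apply: eq_bigr => k _.
  rewrite !mxE; congr (_ * _); apply: eq_bigr => l _.
  by rewrite !mxE.
have : \sum_j q X j + \sum_j q (X^t*) j = 0.
  rewrite -!qE trmxCK [\tr (X *m r *m _)]mxtrace_mulC -raddfD/=.
  by rewrite -mulmxA -mulmxDr rX mulmx0 mxtrace0.
move/eqP; rewrite paddr_eq0 ?sumr_ge0// => /andP[+ _].
rewrite psumr_eq0// => /allP qX.
apply/matrixP => i j; have := qX j; rewrite mem_index_enum => /(_ isT)/=.
have [/colP/(_ i)|/r0 qj] := eqVneq (col j X) 0; first by rewrite !mxE.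
by rewrite /q gt_eqF.
Qed.

Lemma is_sld_uniq r X L L' :
  posdefmx r -> is_sld r X L -> is_sld r X L' -> L = L'.
Proof.
move=> r0 [_ <-] [_ /(scalerI _) eL]; apply/eqP; rewrite -subr_eq0; apply/eqP.
apply: (lyapunov_inj r0).
by rewrite mulmxBr mulmxBl addrACA -opprD eL ?subrr.
Qed.

Lemma sldP r X : posdefmx r -> X \is hermsymmx -> is_sld r X (sld r X).
Proof.
move=> r0 Xh; suff [L LP] : exists L, is_sld r X L by apply: (xgetPex 0); exists L.
have rh := r0.1.
pose M := lin_mulmx r + lin_mulmxr r : 'M[C]_(d * d).
have ME Y : mxvec Y *m M = mxvec (r *m Y + Y *m r).
  by rewrite mulmxDr !mul_vec_lin/= linearD.
have Mu : M \in unitmx.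
  rewrite -row_free_unit -kermx_eq0; apply/rowV0P => v /sub_kermxP.
  rewrite -[v]vec_mxK ME => /(congr1 vec_mx); rewrite mxvecK linear0.
  by move/(lyapunov_inj r0) => ->; rewrite linear0.
pose L := vec_mx (mxvec (2 *: X) *m invmx M).
have LX : r *m L + L *m r = 2 *: X.
  by apply: (can_inj mxvecK); rewrite -ME vec_mxK mulmxKV.
exists L; split; last by rewrite LX scalerA mulVf ?scale1r// pnatr_eq0.
move: Xh rh; rewrite !is_hermitianmxE !expr0 !scale1r => /eqP Xh /eqP rh.
rewrite -subr_eq0; apply/eqP/(lyapunov_inj r0).
rewrite mulmxBr mulmxBl addrACA -opprD LX.
have -> : r *m L^t* + L^t* *m r = (r *m L + L *m r)^t*.
  by rewrite linearD map_mxD/= !trmx_mul !map_mxM -rh addrC.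
by rewrite LX linearZ/= map_mxZ -Xh rmorph_nat subrr.
Qed.

End Sld.

Section Fisher.
Context {R : realType} {d : nat}.
Local Notation C := R[i].
Local Notation g := (d ^ 2 - 1)%N.
Local Notation param := 'rV[R]_g.
Implicit Types (rho : param -> 'M[C]_d) (t : param).

Definition is_density (r : 'M[C]_d) : Prop := posdefmx r /\ \tr r = 1.

Definition is_parametrization (Theta : set param) rho : Prop :=
  open Theta /\
  forall t, Theta t ->
    [/\ is_density (rho t),
        forall i j, cdifferentiable (fun s => rho s i j) t &
        forall c : 'I_g -> R,
          \sum_a (c a)%:C%C *: mxpartial rho a t = 0 -> forall a, c a = 0].

Definition J_S rho t : 'M[C]_g :=
  let L a := sld (rho t) (mxpartial rho a t) in
  \matrix_(a, b) (2^-1 * \tr (rho t *m (L a *m L b + L b *m L a))).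

Definition J_R rho t : 'M[C]_g :=
  \matrix_(a, b)
    \tr (mxpartial rho a t *m invmx (rho t) *m mxpartial rho b t).

Definition J_L rho t : 'M[C]_g :=
  \matrix_(a, b)
    \tr (mxpartial rho a t *m mxpartial rho b t *m invmx (rho t)).

Context {I : finType}.
Implicit Type A : I -> 'M[C]_d.

Definition prob rho A (j : I) t : C := \tr (rho t *m A j).

Definition fisher rho t A : 'M[C]_g :=
  \matrix_(a, b) \sum_(j | A j != 0)
    (prob rho A j t)^-1 * cpartial (prob rho A j) a t
                        * cpartial (prob rho A j) b t.

Definition normalizedI (J : 'M[C]_g) rho t A : 'M[C]_g :=
  invsqrtmx J *m fisher rho t A *m invsqrtmx J.

Definition I_S rho t A := normalizedI (J_S rho t) rho t A.
Definition I_L rho t A := normalizedI (J_L rho t) rho t A.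
Definition I_R rho t A := normalizedI (J_R rho t) rho t A.

Definition sharpness rho t A : nat := mu (I_S rho t A).

End Fisher.

(* Main.v *)
(** For w in {1/2, 1, 0} let K Z = w rho Z + (1 - w) Z rho, so that K is S, L or
    R, and put J = K^-1.  The multiplicity of the eigenvalue 1 of the Hermitian
    operator J^(-1/2) F J^(-1/2) is the dimension of ker (F - J).  With
    c_j = <<A_j|K Z>> / p_j one has

      <<Z|K Z>> - sum_j |<<A_j|K Z>>|^2 / p_j
        = sum_j (w tr (A_j (Z - c_j)^* rho (Z - c_j))
                 + (1 - w) tr (A_j (Z - c_j) rho (Z - c_j)^* )),

    hence F <= J, and equality at K Z forces Z A_j = c_j A_j for all j (or the
    adjoint relation).  Then Z = sum_j c_j A_j and c is constant on the connected
    components of the transition graph, whatever w; conversely every such Z is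
    fixed by F K.  So ker (F - J) has a basis indexed by the components, namely
    the K P_k, where P_k is the sum of the elements of the k-th component.

    Since J - F is positive semidefinite, compressing F and J to a subspace W
    replaces ker (F - J) by its intersection with W.  For the traceless operators
    this intersection is a hyperplane of the kernel, because rho = K 1 lies in
    ker (F - J) and has trace 1.  The barred superoperators are compressions to
    the traceless operators in this sense, and so are the Fisher matrices, which
    are the Gram matrices of F and J in the basis of derivatives of rho. *)

From HB Require Import structures.
Require Import Defs.
From mathcomp Require Import all_boot all_order all_algebra.
From mathcomp Require Import sesquilinear spectral.
From mathcomp Require Import complex ring.
From mathcomp Require Import all_classical all_reals all_analysis.

Set Implicit Arguments.
Unset Strict Implicit.
Unset Printing Implicit Defensive.

Import Order.TTheory GRing.Theory Num.Theory.
Import numFieldNormedType.Exports.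

Local Open Scope ring_scope.
Local Open Scope sesquilinear_scope.

(** * Multiplicity of the eigenvalue 1 of Hermitian matrices; semidefinite forms *)

Section HermitianMatrices.
Context {C : numClosedFieldType}.

Lemma hermP n (M : 'M[C]_n) : reflect (M^t* = M) (M \is hermsymmx).
Proof.
rewrite is_hermitianmxE expr0 scale1r eq_sym; exact: eqP.
Qed.

Lemma adjmxM m n p (M : 'M[C]_(m, n)) (N : 'M[C]_(n, p)) :
  (M *m N)^t* = N^t* *m M^t*.
Proof. by rewrite trmx_mul map_mxM. Qed.

Lemma adjmxD m n (M N : 'M[C]_(m, n)) : (M + N)^t* = M^t* + N^t*.
Proof. by rewrite linearD/= map_mxD. Qed.

Lemma adjmxB m n (M N : 'M[C]_(m, n)) : (M - N)^t* = M^t* - N^t*.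
Proof. by rewrite linearB/= map_mxB. Qed.

Lemma adjmx_sum (T : Type) (s : seq T) (P : pred T) m n (F : T -> 'M[C]_(m, n)) :
  (\sum_(i <- s | P i) F i)^t* = \sum_(i <- s | P i) (F i)^t*.
Proof.
by apply: (big_morph (fun M => M^t*)) => [M N|]; rewrite ?adjmxD ?trmx0 ?map_mx0.
Qed.

Lemma adjmxZ m n (a : C) (M : 'M[C]_(m, n)) : (a *: M)^t* = a^* *: M^t*.
Proof. by rewrite linearZ/= map_mxZ. Qed.

Lemma adjmx_scalar n (a : C) : (a%:M : 'M[C]_n)^t* = a^*%:M.
Proof. by rewrite tr_scalar_mx map_scalar_mx. Qed.

Lemma mxtrace_adj n (M : 'M[C]_n) : \tr (M^t*) = (\tr M)^*.
Proof. by rewrite rmorph_sum; apply: eq_bigr => i _; rewrite !mxE. Qed.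

Lemma adjmx_inv n (M : 'M[C]_n) : (invmx M)^t* = invmx (M^t*).
Proof. by rewrite trmx_inv map_invmx. Qed.

Lemma mxrank_diag n (D : 'rV[C]_n) :
  \rank (diag_mx D) = (\sum_i (D ord0 i != 0%R))%N.
Proof.
elim: n D => [|n IHn] D; first by rewrite flatmx0 mxrank0 big_ord0.
have [L [E ->]] : exists L : 'rV_1, exists E : 'rV_n, D = row_mx L E.
  by exists (lsubmx (D : 'rV_(1 + n))), (rsubmx (D : 'rV_(1 + n))); rewrite hsubmxK.
rewrite -[n.+1]/(1 + n)%N diag_mx_row rank_diag_block_mx IHn.
rewrite big_split_ord big_ord1; congr (_ + _)%N; last first.
  by apply: eq_bigr => i _; rewrite row_mxEr.
rewrite row_mxEl rank_rV; congr (nat_of_bool _); congr negb.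
apply/eqP/eqP => [/rowP/(_ 0)|D0]; first by rewrite !mxE eqxx mulr1n.
by apply/rowP => i; rewrite !mxE D0 mul0rn.
Qed.

Lemma char_poly_conj n (P M : 'M[C]_n) :
  P \in unitmx -> char_poly (invmx P *m M *m P) = char_poly M.
Proof.
move=> Pu; pose f := map_mx (@polyC C) : 'M[C]_n -> 'M[{poly C}]_n.
have fP : f (invmx P) *m f P = 1%:M by rewrite -map_mxM mulVmx// map_mx1.
rewrite /char_poly.
have -> : char_poly_mx (invmx P *m M *m P) = f (invmx P) *m char_poly_mx M *m f P.
  by rewrite /char_poly_mx mulmxBr mulmxBl scalar_mxC -(mulmxA _ (f _)) fP
    mulmx1 !map_mxM.
by rewrite !det_mulmx mulrAC -det_mulmx fP det1 mul1r.
Qed.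

(** A Hermitian matrix is unitarily diagonalizable, so algebraic and geometric multiplicities agree:
    both count the diagonal entries equal to 1. *)
Lemma mu_herm n (M : 'M[C]_n) :
  M \is hermsymmx -> mu M = \rank (kermx (M - 1%:M)).
Proof.
move=> /hermitian_normalmx/orthomx_spectralP; have := spectral_unit M.
move: (spectralmx M) (spectral_diag M) => P D Pu ME.
have MB : M - 1%:M = invmx P *m diag_mx (D - const_mx 1) *m P.
  by rewrite linearB/= diag_const_mx mulmxBr mulmx1 mulmxBl mulVmx// -ME.
rewrite /mu mxrank_ker MB mxrankMfree ?row_free_unit// (eqmxMfull _ _).
  2: by rewrite row_full_unit unitmx_inv.
rewrite ME char_poly_conj// char_poly_trig ?diag_mx_is_trig//.
under eq_bigr do rewrite mxE eqxx mulr1n.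
rewrite mxrank_diag -(big_map (fun i => D 0 i) xpredT (fun y => 'X - y%:P)).
rewrite mu_prod_XsubC count_map -sum1_count big_mkcond.
rewrite -[X in (X - _)%N]card_ord -sum1_card.
(* The subtraction in the dimension of the kernel is truncated; adding back the number of entries
   different from 1 clears it. *)
apply/eqP; rewrite -(eqn_add2r (\sum_i ((D - const_mx 1)%R ord0 i != 0%R)%N)) subnK.
  rewrite -big_split/=; apply/eqP/eq_bigr => i _; rewrite !mxE subr_eq0.
  by case: eqP.
by apply: leq_sum => i _; case: eqP.
Qed.

Lemma posdef_psd n (M : 'M[C]_n) : posdefmx M -> possemidefmx M.
Proof.
move=> [Mh M0]; split=> // v; have [->|/M0/ltW//] := eqVneq v 0.
by rewrite mulmx0 mxE.
Qed.

Lemma psd_congr n m (M : 'M[C]_n) (B : 'M[C]_(n, m)) :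
  possemidefmx M -> possemidefmx (B^t* *m M *m B).
Proof.
move=> [/hermP Mh M0]; split; first by apply/hermP; rewrite !adjmxM trmxCK Mh mulmxA.
by move=> v; have := M0 (B *m v); rewrite adjmxM !mulmxA.
Qed.

Lemma posdef_unit n (M : 'M[C]_n) : posdefmx M -> M \in unitmx.
Proof.
move=> [_ M0]; rewrite -unitmx_tr -row_free_unit; apply: inj_row_free => v vM.
apply/eqP/negP => /negP v0; have vT0 : v^T != 0 by rewrite trmx_eq0.
have := M0 _ vT0; rewrite -mulmxA.
have -> : M *m v^T = 0 by rewrite -[M]trmxK -trmx_mul vM trmx0.
by rewrite mulmx0 mxE ltxx.
Qed.

Lemma posdef_inv n (M : 'M[C]_n) : posdefmx M -> posdefmx (invmx M).
Proof.
move=> Mp; have Mu := posdef_unit Mp; have [/hermP Mh M0] := Mp; split.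
  by apply/hermP; rewrite adjmx_inv Mh.
move=> v v0; have w0 : invmx M *m v != 0.
  by apply: contraNneq v0 => w0; rewrite -(mulKVmx Mu v) w0 mulmx0.
by have := M0 _ w0; rewrite adjmxM adjmx_inv Mh mulmxKV// mulmxA.
Qed.

Lemma posdef_congr m n (B : 'M[C]_(m, n)) (M : 'M[C]_n) :
  row_free B -> posdefmx M -> posdefmx (B *m M *m B^t*).
Proof.
move=> Bf [/hermP Mh M0]; split.
  by apply/hermP; rewrite !adjmxM trmxCK Mh mulmxA.
move=> v v0; have w0 : B^t* *m v != 0.
  apply: contraNneq v0 => w0; have : v^t* *m B = 0.
    by rewrite -[B]trmxCK -adjmxM w0 trmx0 map_mx0.
  move/eqP; rewrite mulmx_free_eq0// => /eqP.
  by move/(congr1 (fun X => X^t*)); rewrite trmxCK trmx0 map_mx0 => ->.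
by have := M0 _ w0; rewrite adjmxM trmxCK !mulmxA.
Qed.

(** With S the square root of M, v M v^* is the squared norm of v S, and v M = v S S. Isotropic
    vectors of a semidefinite form thus lie in its kernel. *)
Lemma psd_row_eq0 n (M : 'M[C]_n) (v : 'rV[C]_n) :
  possemidefmx M -> v *m M *m v^t* = 0 -> v *m M = 0.
Proof.
move=> Mp vMv; have [/hermP Sh _] := sqrtmx_psd Mp.
rewrite -(sqrtmxK Mp) mulmxA; set w := v *m sqrtmx M.
suff -> : w = 0 by rewrite mul0mx.
have : w *m w^t* = 0.
  by rewrite adjmxM Sh mulmxA -(mulmxA v) sqrtmxK.
move/matrixP/(_ 0 0); rewrite !mxE => /eqP.
rewrite psumr_eq0 => [/allP w0|i _]; last by rewrite !mxE mul_conjC_ge0.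
apply/rowP => i; have := w0 i; rewrite mem_index_enum !mxE => /(_ isT)/=.
by rewrite mul_conjC_eq0 => /eqP.
Qed.

(** Subtracting 1 leaves J^(-1/2) (F - J) J^(-1/2), and invertible factors do not change the
    rank. *)
Lemma mu_normalized n (J F : 'M[C]_n) : posdefmx J -> F \is hermsymmx ->
  mu (invsqrtmx J *m F *m invsqrtmx J) = \rank (kermx (F - J)).
Proof.
move=> Jp /hermP Fh; have SS := sqrtmxK (posdef_psd Jp).
have [/hermP Sh _] := sqrtmx_psd (posdef_psd Jp).
have Su : sqrtmx J \in unitmx.
  by have := posdef_unit Jp; rewrite -{1}SS unitmx_mul andbb.
rewrite /invsqrtmx; move: (sqrtmx J) SS Sh Su => S <- Sh Su {J Jp}.
rewrite mu_herm; last by apply/hermP; rewrite !adjmxM adjmx_inv Sh Fh mulmxA.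
have -> : invmx S *m F *m invmx S - 1%:M = invmx S *m (F - S *m S) *m invmx S.
  by rewrite mulmxBr mulmxBl mulKmx// mulmxV.
have Iu : invmx S \in unitmx by rewrite unitmx_inv.
rewrite !mxrank_ker mxrankMfree ?row_free_unit//.
by rewrite (eqmxMfull _ _) ?row_full_unit.
Qed.

End HermitianMatrices.

(** * The superoperators L, R and S as one family; traces of products of positive matrices *)

Section Superoperators.
Context {C : numClosedFieldType} {d : nat}.
Implicit Types (X Y Z r : 'M[C]_d).

Lemma mxvec_adj_dot X Y : (mxvec X *m (mxvec Y)^t*) 0 0 = hsdot Y X.
Proof.
rewrite /hsdot mxtrace_mulC mxE; under eq_bigr do rewrite !mxE.
rewrite (reindex _ (curry_mxvec_bij _ _))/= /mxtrace.
under [RHS]eq_bigr do rewrite mxE.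
rewrite pair_bigA; apply: eq_bigr => -[i j] _ /=.
by rewrite !mxvecE !mxE.
Qed.

Lemma hsdotC X Y : hsdot Y X = (hsdot X Y)^*.
Proof. by rewrite -mxtrace_adj adjmxM trmxCK. Qed.

Lemma lin_mx_herm (f : {linear 'M[C]_d -> 'M[C]_d}) :
  (forall X Y, hsdot Y (f X) = hsdot (f Y) X) -> lin_mx f \is hermsymmx.
Proof.
move=> fC; apply/hermP/matrixP => a b.
have E c e : lin_mx f c e =
    (mxvec (f (vec_mx (delta_mx 0 c))) *m (mxvec (vec_mx (delta_mx 0 e)))^t*) 0 0.
  rewrite -mul_rV_lin vec_mxK -rowE trmx_delta map_delta_mx -colE !mxE//.
transitivity ((lin_mx f b a)^*); first by rewrite !mxE.
by rewrite !E !mxvec_adj_dot fC hsdotC conjCK.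
Qed.

(* The values 1, 0 and 1/2 of [w] give the superoperators L, R and S. *)
Definition mixop (w : C) r X : 'M[C]_d := w *: (r *m X) + (1 - w) *: (X *m r).

Lemma mixop_linear w r : linear (mixop w r).
Proof.
move=> a X Y; rewrite /mixop mulmxDr mulmxDl -scalemxAr -scalemxAl.
by rewrite scalerDr (scalerDr (1 - w)) scalerDr !scalerA -!(mulrC a) addrACA.
Qed.

HB.instance Definition _ w r :=
  GRing.isLinear.Build C 'M[C]_d 'M[C]_d *:%R (mixop w r) (mixop_linear w r).

Lemma calLE r : calL r = lin_mx (mixop 1 r).
Proof.
by congr lin_mx; apply/funext => X; rewrite /mixop subrr scale0r addr0 scale1r.
Qed.

Lemma calRE r : calR r = lin_mx (mixop 0 r).
Proof.
by congr lin_mx; apply/funext => X; rewrite /mixop subr0 scale0r add0r scale1r.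
Qed.

Lemma subr_half : 1 - 2^-1 = 2^-1 :> C.
Proof.
by apply/eqP; rewrite subr_eq -mulr2n -[2^-1 *+ 2]mulr_natr mulVf ?pnatr_eq0.
Qed.

Lemma calSE r : calS r = lin_mx (mixop 2^-1 r).
Proof.
rewrite /calS calLE calRE; apply/row_matrixP => i.
rewrite !rowE -scalemxAr mulmxDr !mul_rV_lin -linearD -linearZ/=; congr mxvec.
rewrite /mixop subrr subr0 !scale1r !scale0r addr0 add0r scalerDr.
by rewrite subr_half.
Qed.

(** The map inside [ketbra], named so that a linear structure can be attached to it. *)
Definition hs_outer X Y Z : 'M[C]_d := hsdot Y Z *: X.

Lemma hs_outer_linear X Y : linear (hs_outer X Y).
Proof.
move=> a Z T; rewrite /hs_outer /hsdot mulmxDr -scalemxAr mxtraceD mxtraceZ.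
by rewrite scalerDl scalerA.
Qed.

HB.instance Definition _ X Y :=
  GRing.isLinear.Build C 'M[C]_d 'M[C]_d *:%R (hs_outer X Y) (hs_outer_linear X Y).

Lemma trace_cong_psd r X : possemidefmx r -> 0 <= \tr (X^t* *m r *m X).
Proof.
move=> rp; have [/hermP Sh _] := sqrtmx_psd rp.
have -> : X^t* *m r *m X = (sqrtmx r *m X)^t* *m (sqrtmx r *m X).
  by rewrite adjmxM Sh mulmxA -(mulmxA (X^t*) (sqrtmx r)) sqrtmxK.
rewrite mxtrace_mulC; apply: sumr_ge0 => i _; rewrite mxE; apply: sumr_ge0 => j _.
by rewrite !mxE mul_conjC_ge0.
Qed.

Lemma trace_adj_eq0 (n p : nat) (X : 'M[C]_(n, p)) : \tr (X^t* *m X) = 0 -> X = 0.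
Proof.
rewrite mxtrace_mulC => /eqP; rewrite psumr_eq0 => [/allP X0|i _]; last first.
  by rewrite mxE; apply: sumr_ge0 => j _; rewrite !mxE mul_conjC_ge0.
apply/matrixP => i j; have := X0 i; rewrite mem_index_enum mxE => /(_ isT).
rewrite psumr_eq0 => [/allP/(_ j)|k _]; last by rewrite !mxE mul_conjC_ge0.
by rewrite mem_index_enum !mxE mul_conjC_eq0 => /(_ isT)/eqP.
Qed.

Lemma trace_cong_eq0 r X : posdefmx r -> \tr (X^t* *m r *m X) = 0 -> X = 0.
Proof.
move=> rp; have [/hermP Sh _] := sqrtmx_psd (posdef_psd rp).
have SS := sqrtmxK (posdef_psd rp).
have Su : sqrtmx r \in unitmx.
  by have := posdef_unit rp; rewrite -{1}SS unitmx_mul andbb.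
have -> : X^t* *m r *m X = (sqrtmx r *m X)^t* *m (sqrtmx r *m X).
  by rewrite adjmxM Sh mulmxA -(mulmxA (X^t*) (sqrtmx r)) SS.
by move/trace_adj_eq0/(congr1 (mulmx (invmx (sqrtmx r)))); rewrite mulKmx// mulmx0.
Qed.

Lemma trace_mul_psd X Y : possemidefmx X -> possemidefmx Y -> 0 <= \tr (X *m Y).
Proof.
move=> Xp Yp; have [/hermP Sh _] := sqrtmx_psd Xp.
rewrite -(sqrtmxK Xp) -mulmxA mxtrace_mulC -{1}Sh; exact: trace_cong_psd.
Qed.

(** The trace of X Y is the squared Hilbert-Schmidt norm of sqrt X sqrt Y, and this product is the
    middle factor of X Y. *)
Lemma trace_mul_psd_eq0 X Y : possemidefmx X -> possemidefmx Y ->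
  \tr (X *m Y) = 0 -> X *m Y = 0.
Proof.
move=> Xp Yp; have [/hermP Sh _] := sqrtmx_psd Xp; have [/hermP Th _] := sqrtmx_psd Yp.
have Xs := sqrtmxK Xp; have Ys := sqrtmxK Yp.
move=> XY0; have : sqrtmx X *m sqrtmx Y = 0.
  apply: trace_adj_eq0; rewrite adjmxM Sh Th mulmxA -(mulmxA (sqrtmx Y)) Xs.
  by rewrite mxtrace_mulC mulmxA Ys mxtrace_mulC.
by move=> ST; rewrite -Xs -Ys mulmxA -(mulmxA (sqrtmx X)) ST mulmx0 mul0mx.
Qed.

Section MixedMultiplication.
Context {w : C} {r : 'M[C]_d}.
Hypotheses (w0 : 0 <= w) (w1 : w <= 1) (rp : posdefmx r).

Let wr : w^* = w. Proof. exact/CrealP/ger0_real. Qed.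
Let v0 : 0 <= 1 - w. Proof. by rewrite subr_ge0. Qed.
Let vr : (1 - w)^* = 1 - w. Proof. exact/CrealP/ger0_real. Qed.
Let rh : r^t* = r. Proof. exact/hermP/(proj1 rp). Qed.

Lemma hsdot_mixop X Y :
  hsdot X (mixop w r Y) = w * \tr (X^t* *m r *m Y) + (1 - w) * \tr (X^t* *m Y *m r).
Proof.
by rewrite /hsdot /mixop mulmxDr -!scalemxAr mxtraceD !mxtraceZ !mulmxA.
Qed.

Lemma hsdot_mixopC X Y : hsdot Y (mixop w r X) = hsdot (mixop w r Y) X.
Proof.
rewrite [RHS]hsdotC !hsdot_mixop rmorphD !rmorphM/= wr vr -!mxtrace_adj.
rewrite !adjmxM trmxCK rh !mulmxA; congr (_ + _ * _).
by rewrite mxtrace_mulC mulmxA.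
Qed.

Lemma hsdot_mixop_gt0 X : X != 0 -> 0 < hsdot X (mixop w r X).
Proof.
move=> X0; have rp' := posdef_psd rp; rewrite hsdot_mixop.
have -> : \tr (X^t* *m X *m r) = \tr ((X^t*)^t* *m r *m X^t*).
  by rewrite trmxCK -mulmxA mxtrace_mulC.
have t1 : 0 < \tr (X^t* *m r *m X).
  rewrite lt_def trace_cong_psd// andbT; apply: contraNneq X0.
  by move/(trace_cong_eq0 rp)->.
have t2 : 0 < \tr ((X^t*)^t* *m r *m X^t*).
  rewrite lt_def trace_cong_psd// andbT; apply: contraNneq X0.
  by move/(trace_cong_eq0 rp) => X0; rewrite -[X]trmxCK X0 trmx0 map_mx0.
(* The weights sum to 1, so one of the two positive traces has a positive weight. *)
have [->|wn0] := eqVneq w 0; first by rewrite subr0 mul0r add0r mul1r.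
by rewrite ltr_wpDr ?mulr_ge0 ?mulr_gt0// ?ltW// lt_def wn0.
Qed.

Lemma mixop_posdef : posdefmx (lin_mx (mixop w r)).
Proof.
split; first by apply: lin_mx_herm => X Y; exact: hsdot_mixopC.
move=> v v0'; have [X vE] : exists X, v = (mxvec X)^t*.
  by exists (vec_mx (v^t*)); rewrite vec_mxK trmxCK.
rewrite vE in v0' *; rewrite trmxCK mul_vec_lin mxvec_adj_dot hsdot_mixop_gt0//=.
by apply: contraNneq v0' => ->; rewrite linear0 trmx0 map_mx0.
Qed.

End MixedMultiplication.

End Superoperators.

(** * The inequality F <= J and its equality case *)

Section Povms.
Context {C : numClosedFieldType} {d : nat} {I : finType}.
Variables (A : I -> 'M[C]_d) (w : C) (r : 'M[C]_d).
Hypotheses (Ap : is_povm A) (w0 : 0 <= w) (w1 : w <= 1) (rp : posdefmx r).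
Implicit Types (X Y Z : 'M[C]_d) (c : I -> C).

Let Apsd j : possemidefmx (A j). Proof. exact: (proj1 Ap). Qed.
Let Ah j : (A j)^t* = A j. Proof. exact/hermP/(proj1 (Apsd j)). Qed.
Let A1 : \sum_j A j = 1%:M. Proof. exact: (proj2 Ap). Qed.
Let rh : r^t* = r. Proof. exact/hermP/(proj1 rp). Qed.

Let p j := \tr (r *m A j).

Lemma povm_mul_eq0 j k : hsdot (A j) (A k) = 0 -> A j *m A k = 0.
Proof. by rewrite /hsdot Ah; apply: trace_mul_psd_eq0. Qed.

Lemma trace_povm_gt0 j : A j != 0 -> 0 < p j.
Proof.
move=> Aj0; rewrite lt_def trace_mul_psd ?andbT//; last exact: posdef_psd.
apply: contraNneq Aj0 => /trace_mul_psd_eq0-/(_ (posdef_psd rp) (Apsd j)) rA.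
by rewrite -(mulKmx (posdef_unit rp) (A j)) rA mulmx0.
Qed.

Lemma trace_sum_povm X : \tr X = \sum_j \tr (A j *m X).
Proof. by rewrite -{1}[X]mul1mx -A1 mulmx_suml raddf_sum. Qed.

(* Computing [\tr (Z *m Z^t* )] with either factor expanded in the [A j] gives
   [\sum_j \sum_k `|c j - c k| ^+ 2 * \tr (A j *m A k) = 0]. *)
Lemma joint_eigen_const Z c : (forall j, Z *m A j = c j *: A j) ->
  forall j k, A j *m A k != 0 -> c j = c k.
Proof.
move=> Zc.
have ZE : Z = \sum_j c j *: A j.
  by rewrite -[Z]mulmx1 -A1 mulmx_sumr; apply: eq_bigr => j _.
pose a j k := \tr (A j *m A k).
have aC j k : a j k = a k j by rewrite /a mxtrace_mulC.
have a0 j k : 0 <= a j k by apply: trace_mul_psd.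
have sumk j : \tr (A j) = \sum_k a j k.
  by rewrite -[A j]mulmx1 -A1 mulmx_sumr raddf_sum.
have Zs : Z^t* = \sum_k (c k)^* *: A k.
  by rewrite ZE adjmx_sum; apply: eq_bigr => k _; rewrite adjmxZ Ah.
pose T := \tr (Z *m Z^t*).
have ZZ1 : \sum_j \sum_k c j * (c k)^* * a j k = T.
  rewrite /T Zs {1}ZE mulmx_suml raddf_sum; apply: eq_bigr => j _.
  rewrite mulmx_sumr raddf_sum; apply: eq_bigr => k _.
  by rewrite -scalemxAl -scalemxAr /= !mxtraceZ mulrA.
have ZZ2 : \sum_j \sum_k c j * (c j)^* * a j k = T.
  (* Here the identity between the factors is expanded instead: Z A_j Z^* is |c_j|^2 A_j. *)
  have -> : T = \tr (Z *m 1%:M *m Z^t*) by rewrite mulmx1.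
  rewrite -A1 mulmx_sumr mulmx_suml raddf_sum.
  apply: eq_bigr => j _; rewrite -mulr_sumr -sumk Zc -scalemxAl /= mxtraceZ.
  have /(congr1 (fun X => X^t*)) := Zc j; rewrite adjmxM Ah adjmxZ Ah => ->.
  by rewrite mxtraceZ mulrA.
have ZZ3 : \sum_j \sum_k c k * (c j)^* * a j k = T.
  rewrite -ZZ1 exchange_big/=; apply: eq_bigr => j _.
  by apply: eq_bigr => k _; rewrite aC.
have ZZ4 : \sum_j \sum_k c k * (c k)^* * a j k = T.
  rewrite -ZZ2 exchange_big/=; apply: eq_bigr => j _.
  by apply: eq_bigr => k _; rewrite aC.
have S0 : \sum_j \sum_k `|c j - c k| ^+ 2 * a j k = 0.
  (* Expanding the square gives the four double sums above, all equal to T, with signs that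
     cancel. *)
  under eq_bigr => j _ do under eq_bigr => k _ do
    rewrite normCK rmorphB/= mulrBl !mulrBr !mulrBl.
  under eq_bigr => j _ do rewrite !sumrB.
  by rewrite !sumrB ZZ1 ZZ2 ZZ3 ZZ4 !subrr.
move=> j k jk; have q0 i l : 0 <= `|c i - c l| ^+ 2 * a i l.
  by rewrite mulr_ge0 ?exprn_ge0.
move/eqP: S0; rewrite psumr_eq0 => [/allP/(_ j)|i _]; last exact: sumr_ge0.
rewrite mem_index_enum => /(_ isT); rewrite psumr_eq0// => /allP/(_ k).
rewrite mem_index_enum => /(_ isT)/=; rewrite mulf_eq0 expf_eq0/= normr_eq0 subr_eq0.
case/orP => [/eqP//|/eqP /trace_mul_psd_eq0 jk0].
by rewrite jk0 ?eqxx in jk.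
Qed.

(** The scalar closest to Z for the seminorm weighted by A_j, in which 1 has squared norm p_j. The
    j-th part of the gap is then the squared distance from Z to the scalars. *)
Let kF Z j := hsdot (A j) (mixop w r Z) / p j.

(* The left-hand side is the quadratic form of [calJ - calF] at [mixop w r Z]. *)
Lemma bessel_gap Z :
  hsdot Z (mixop w r Z) - \sum_j `|hsdot (A j) (mixop w r Z)| ^+ 2 / p j =
  \sum_j (w * \tr (A j *m ((Z - (kF Z j)%:M)^t* *m r *m (Z - (kF Z j)%:M))) +
    (1 - w) * \tr (A j *m ((Z - (kF Z j)%:M) *m r *m (Z - (kF Z j)%:M)^t*))).
Proof.
have wr : w^* = w by exact/CrealP/ger0_real.
(* The resolution of the identity splits the form at Z over j, so that the identity can be checked
   for each j separately. *)
have -> : hsdot Z (mixop w r Z) = \sum_j (w * \tr (A j *m (Z^t* *m r *m Z)) +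
    (1 - w) * \tr (A j *m (Z *m r *m Z^t*))).
  rewrite big_split/= -!mulr_sumr -!trace_sum_povm hsdot_mixop; congr (_ + _ * _).
  by rewrite -!mulmxA mxtrace_mulC mulmxA.
rewrite -sumrB; apply: eq_bigr => j _.
have aE : hsdot (A j) (mixop w r Z) =
    w * \tr (A j *m r *m Z) + (1 - w) * \tr (A j *m Z *m r).
  by rewrite hsdot_mixop Ah.
have aS : (hsdot (A j) (mixop w r Z))^* =
    w * \tr (A j *m Z^t* *m r) + (1 - w) * \tr (A j *m r *m Z^t*).
  rewrite aE rmorphD !rmorphM rmorphB/= wr rmorph1 -!mxtrace_adj !adjmxM Ah rh.
  by rewrite !mulmxA ![\tr (_ *m A j)]mxtrace_mulC !mulmxA.
(* Zero elements are set apart: both numerator and scalar are 0 there, so the two sides consist of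
   the same traces. Otherwise p_j is real and invertible. *)
have [a0 | p0] : hsdot (A j) (mixop w r Z) = 0 /\ kF Z j = 0 \/
    p j != 0 /\ (kF Z j)^* = (hsdot (A j) (mixop w r Z))^* / p j.
  have [Aj0|/trace_povm_gt0 pj0] := eqVneq (A j) 0.
    have a0 : hsdot (A j) (mixop w r Z) = 0.
      by rewrite /hsdot Aj0 trmx0 map_mx0 mul0mx mxtrace0.
    by left; rewrite /kF a0 mul0r.
  right; split; first by rewrite gt_eqF.
  by rewrite /kF rmorphM/= fmorphV/=; congr (_ / _); apply/CrealP/ger0_real/ltW.
  case: a0 => [a0 ->]; rewrite a0 normr0 expr0n mul0r subr0.
  by rewrite -scalemx1 scale0r subr0.
case: p0 => [p0 cS]; have cE : kF Z j = hsdot (A j) (mixop w r Z) / p j by [].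
rewrite normCK; move: aE aS cE cS; set c := kF Z j.
(* The conjugates become independent variables, tied only by the equations at hand, which reduces
   the goal to an identity of fractions. *)
rewrite adjmxB adjmx_scalar; move: c^* => c'.
set a := hsdot _ _; move: a^* => a'.
rewrite !(mulmxBl, mulmxBr) !(mul_scalar_mx, mul_mx_scalar).
rewrite -!(scalemxAl, scalemxAr) !raddfB/= !mxtraceZ.
rewrite !mulmxA => -> -> -> ->.
have -> : p j = \tr (A j *m r) by rewrite /p mxtrace_mulC.
by field; move: p0; rewrite /p mxtrace_mulC.
Qed.

Let gap Z :=
  hsdot Z (mixop w r Z) - \sum_j `|hsdot (A j) (mixop w r Z)| ^+ 2 / p j.

Let conjmx_psd X : possemidefmx (X *m r *m X^t*).
Proof.
by have := psd_congr (X^t*) (posdef_psd rp); rewrite trmxCK.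
Qed.

Let gap_term1 Z j : 0 <= w *
  \tr (A j *m ((Z - (kF Z j)%:M)^t* *m r *m (Z - (kF Z j)%:M))).
Proof. by rewrite mulr_ge0// trace_mul_psd//; exact/psd_congr/posdef_psd. Qed.

Let gap_term2 Z j : 0 <= (1 - w) *
  \tr (A j *m ((Z - (kF Z j)%:M) *m r *m (Z - (kF Z j)%:M)^t*)).
Proof. by rewrite mulr_ge0 ?subr_ge0// trace_mul_psd. Qed.

Lemma bessel_gap_ge0 Z : 0 <= gap Z.
Proof. by rewrite /gap bessel_gap sumr_ge0// => j _; rewrite addr_ge0. Qed.

(** A vanishing trace of two semidefinite factors makes A_j Y^* r Y zero, hence also the form of r
    at Y A_j, and r is definite. *)
Let killed Y j : \tr (A j *m (Y^t* *m r *m Y)) = 0 -> Y *m A j = 0.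
Proof.
move=> /trace_mul_psd_eq0-/(_ (Apsd j) (psd_congr _ (posdef_psd rp))) AY.
apply: (trace_cong_eq0 rp).
rewrite !mulmxA in AY.
by rewrite adjmxM Ah !mulmxA AY mul0mx mxtrace0.
Qed.

(** Nonnegative terms vanish one by one. For w nonzero the first trace gives Z A_j = c_j A_j; for w
    = 0 only the second remains and gives the relation for the adjoint of Z. Summing over j recovers
    Z. *)
Lemma bessel_gap_eq0 Z : gap Z = 0 -> exists c,
  Z = \sum_j c j *: A j /\ (forall j k, A j *m A k != 0 -> c j = c k).
Proof.
rewrite /gap bessel_gap => /eqP; rewrite psumr_eq0 => [/allP g0|j _]; last first.
  by rewrite addr_ge0.
have {g0} g0 j : w * \tr (A j *m ((Z - (kF Z j)%:M)^t* *m r *m (Z - (kF Z j)%:M))) = 0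
    /\ (1 - w) * \tr (A j *m ((Z - (kF Z j)%:M) *m r *m (Z - (kF Z j)%:M)^t*)) = 0.
  have := g0 j; rewrite mem_index_enum => /(_ isT)/=.
  by rewrite paddr_eq0// => /andP[/eqP ? /eqP ?].
have sumE (c : I -> C) Y : (forall j, Y *m A j = c j *: A j) -> Y = \sum_j c j *: A j.
  by move=> Yc; rewrite -[Y]mulmx1 -A1 mulmx_sumr; apply: eq_bigr.
have [w00|wn0] := eqVneq w 0; last first.
  have Zc j : Z *m A j = kF Z j *: A j.
    have [/eqP + _] := g0 j; rewrite mulf_eq0 (negPf wn0) => /eqP/killed/eqP.
    by rewrite mulmxBl mul_scalar_mx subr_eq0 => /eqP.
  by exists (kF Z); split; [exact: sumE | exact: joint_eigen_const Zc].
have Zc j : Z^t* *m A j = (kF Z j)^* *: A j.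
  have [_ /eqP] := g0 j; rewrite w00 subr0 mul1r => /eqP.
  rewrite -{1}[Z - _]trmxCK => /killed/eqP.
  by rewrite adjmxB adjmx_scalar mulmxBl mul_scalar_mx subr_eq0 => /eqP.
exists (kF Z); split.
  rewrite -[LHS]trmxCK (sumE _ _ Zc) adjmx_sum; apply: eq_bigr => j _.
  by rewrite adjmxZ Ah conjCK.
move=> j k jk; apply: (can_inj conjCK); exact: joint_eigen_const Zc _ _ jk.
Qed.

Let F := calF r A.
Let K : 'M[C]_(d * d) := lin_mx (mixop w r).
Let J := invmx K.

Let Kp : posdefmx K. Proof. exact: mixop_posdef. Qed.
Let Jp : posdefmx J. Proof. exact: posdef_inv. Qed.
Let Ku : K \in unitmx. Proof. exact: posdef_unit. Qed.

(** Zero elements contribute 0, so the sum may run over all j and be compared with the resolution of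
    the identity. *)
Lemma mul_vec_calF Y : mxvec Y *m F = mxvec (\sum_j (hsdot (A j) Y / p j) *: A j).
Proof.
rewrite /F /calF mulmx_sumr linear_sum [RHS](bigID (fun j => A j != 0))/=.
rewrite [X in _ = _ + X]big1; last first.
  by move=> j; rewrite negbK => /eqP ->; rewrite scaler0 linear0.
rewrite addr0; apply: eq_bigr => j _.
have -> : ketbra (A j) (A j) = lin_mx (hs_outer (A j) (A j)) by [].
by rewrite -scalemxAr mul_vec_lin/= /hs_outer linearZ/= [in RHS]linearZ/= scalerA mulrC.
Qed.

Lemma calF_herm : F \is hermsymmx.
Proof.
have Fh : F^t* = F.
  rewrite /F /calF adjmx_sum; apply: eq_bigr => j Aj0; rewrite adjmxZ.
  have -> : ketbra (A j) (A j) = lin_mx (hs_outer (A j) (A j)) by [].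
  congr (_ *: _); first by apply/CrealP/ger0_real; rewrite invr_ge0 ltW ?trace_povm_gt0.
  apply/hermP/lin_mx_herm => X Y; rewrite /= /hs_outer /hsdot -scalemxAr mxtraceZ.
  by rewrite adjmxZ -scalemxAl mxtraceZ -mxtrace_adj adjmxM trmxCK mulrC Ah.
exact/hermP.
Qed.

(** K is invertible, so every vector is some K Z, and J sends it back to Z: hence the choice of K Z
    as argument. *)
Lemma gap_form Z : (mxvec (mixop w r Z) *m (J - F) *m (mxvec (mixop w r Z))^t*) 0 0
  = gap Z.
Proof.
rewrite mulmxBr mul_vec_calF -{1}mul_vec_lin mulmxK// mulmxBl.
rewrite [LHS]mxE [in X in _ + X]mxE.
rewrite !mxvec_adj_dot; congr (_ - _); first by rewrite -hsdot_mixopC.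
rewrite /hsdot mulmx_sumr raddf_sum; apply: eq_bigr => j _.
rewrite -scalemxAr /= mxtraceZ -/(hsdot _ _) -/(hsdot _ _) normCK mulrAC.
by rewrite -hsdotC.
Qed.

Lemma calJ_sub_calF_psd : possemidefmx (J - F).
Proof.
split.
  apply/hermP; rewrite adjmxB; have /hermP -> := calF_herm.
  by have /hermP -> := proj1 Jp.
move=> v; pose Z := vec_mx (v^t* *m J).
have -> : v = (mxvec (mixop w r Z))^t*.
  by rewrite -mul_vec_lin vec_mxK mulmxKV// trmxCK.
by rewrite trmxCK gap_form bessel_gap_ge0.
Qed.

End Povms.

(** * Projectors attached to the components of the transition graph *)

Section Components.
Context {C : numClosedFieldType} {d : nat} {I : finType}.
Variable A : I -> 'M[C]_d.
Hypothesis Ap : is_povm A.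

Let Apsd j : possemidefmx (A j). Proof. exact: (proj1 Ap). Qed.
Let Ah j : (A j)^t* = A j. Proof. exact/hermP/(proj1 (Apsd j)). Qed.
Let A1 : \sum_j A j = 1%:M. Proof. exact: (proj2 Ap). Qed.
Let e := povm_adj A.
Local Notation rep := (fingraph.root e).

Lemma povm_adj_csym : connect_sym e.
Proof.
have es : symmetric e.
  by move=> j k; rewrite /e /povm_adj/= eq_sym hsdotC conjC_eq0.
exact: sym_connect_sym.
Qed.

Lemma povm_mul_root j k : rep j != rep k -> A j *m A k = 0.
Proof.
move=> jk; apply: (povm_mul_eq0 Ap); apply/eqP; apply: contraNT jk => h0.
have [->//|njk] := eqVneq j k.
by apply/eqP/(fingraph.rootP povm_adj_csym)/connect1; rewrite /e /povm_adj/= njk.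
Qed.

(** The level set of c through j is closed under adjacency, so it contains the root of j. *)
Lemma const_root (c : I -> C) : (forall j k, A j *m A k != 0 -> c j = c k) ->
  forall j, c j = c (rep j).
Proof.
move=> cc j; have cl : fingraph.closed e [pred k | c k == c j].
  move=> k l; rewrite /e /povm_adj/= !inE => /andP[_ kl].
  have -> // : c k = c l.
  by apply: cc; apply: contraNneq kl => kl; rewrite /hsdot Ah kl mxtrace0.
have := closed_connect cl (connect_root e j); rewrite !inE eqxx.
by move/esym/eqP.
Qed.

(** Components are named by their roots; the sum is empty when k is not a root. *)
Definition povm_comp k := \sum_(j | rep j == k) A j.

(** Products across components vanish, so for the component of j the sum can be completed to the
    identity. *)
Lemma povm_comp_mulr k j : povm_comp k *m A j = if rep j == k then A j else 0.
Proof.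
rewrite /povm_comp mulmx_suml; case: eqP => [<-|/eqP jk].
  rewrite -[RHS]mul1mx -A1 mulmx_suml [RHS]
    (bigID (fun i => rep i == rep j))/=.
  by rewrite [X in _ + X]big1 ?addr0// => i /povm_mul_root.
by rewrite big1// => i /eqP ik; rewrite povm_mul_root// ik eq_sym.
Qed.

Lemma povm_comp_herm k : (povm_comp k)^t* = povm_comp k.
Proof. by rewrite /povm_comp adjmx_sum; apply: eq_bigr => j _. Qed.

Lemma povm_comp_mull k j : A j *m povm_comp k = if rep j == k then A j else 0.
Proof.
rewrite -[LHS]trmxCK adjmxM povm_comp_herm Ah povm_comp_mulr; case: ifP => // _.
by rewrite trmx0 map_mx0.
Qed.

(** The predicate counted by [proj_index]: [#|S|] and [proj_index A] are convertible. *)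
Let S : pred I := [predI fingraph.roots e & [pred j | A j != 0]].

Definition comp_mx : 'M[C]_(proj_index A, d * d) :=
  \matrix_(k < #|S|) mxvec (povm_comp (enum_val k)).

Lemma sum_const_comp_mx (c : I -> C) :
  (forall j k, A j *m A k != 0 -> c j = c k) ->
  (mxvec (\sum_j c j *: A j) <= comp_mx)%MS.
Proof.
move=> /const_root cr.
have -> : \sum_j c j *: A j = \sum_(k in S) c k *: povm_comp k.
  have -> : \sum_j c j *: A j = \sum_(j | A j != 0) c j *: A j.
    rewrite [LHS](bigID (fun j => A j != 0))/= [X in _ + X]big1 ?addr0//.
    by move=> j; rewrite negbK => /eqP ->; rewrite scaler0.
  rewrite (partition_big rep S)/=; last first.
    move=> j Aj; rewrite /S/= !inE roots_root; last exact: povm_adj_csym.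
    (* Adjacent elements are both nonzero, so the root of a nonzero element is nonzero and belongs
       to [S]. *)
    have cl : fingraph.closed e [pred k | A k != 0].
      move=> k l; rewrite /e /povm_adj/= !inE => /andP[_ kl].
      have [Ak0|_] := eqVneq (A k) 0.
        by rewrite /hsdot Ak0 trmx0 map_mx0 mul0mx mxtrace0 eqxx in kl.
      by apply/esym/eqP => Al0; rewrite /hsdot Al0 mulmx0 mxtrace0 eqxx in kl.
    by have := closed_connect cl (connect_root e j); rewrite !inE Aj.
  apply: eq_bigr => k _; rewrite /povm_comp scaler_sumr
    [RHS](bigID (fun j => A j != 0))/=.
  rewrite [X in _ = _ + X]big1 ?addr0.
    rewrite [LHS](eq_bigl (fun j => (rep j == k) && (A j != 0))); last first.
      by move=> j; rewrite andbC.
    by apply: eq_bigr => j /andP[/eqP <- _]; rewrite cr.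
  by move=> j /andP[_]; rewrite negbK => /eqP ->; rewrite scaler0.
rewrite linear_sum summx_sub// => k kS; rewrite linearZ scalemx_sub//.
rewrite [X in (X <= _)%MS](_ : _ = row (enum_rank_in kS k : 'I_#|S|) comp_mx).
  2: by rewrite rowK enum_rankK_in.
exact: row_sub.
Qed.

Lemma comp_mx_free : row_free comp_mx.
Proof.
apply: inj_row_free => u u0; apply/rowP => l; rewrite mxE.
pose x := enum_val (l : 'I_#|S|); have : x \in S by exact: enum_valP.
rewrite !inE => /andP[/eqP xr x0].
have : \sum_(k < #|S|) u 0 k *: povm_comp (enum_val k) = 0.
  apply: (can_inj mxvecK); rewrite linear0 -u0 mulmx_sum_row linear_sum.
  by apply: eq_bigr => k _; rewrite rowK linearZ.
(* Multiplication by the nonzero element at the root x kills every term but that of its own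
   component. *)
move/(congr1 (mulmx^~ (A x))); rewrite mul0mx mulmx_suml (bigD1 l)//= big1 ?addr0.
  rewrite -scalemxAl povm_comp_mulr xr eqxx => /eqP.
  by rewrite scaler_eq0 (negPf x0) orbF => /eqP.
move=> k kl; rewrite -scalemxAl povm_comp_mulr xr.
by rewrite (inj_eq enum_val_inj) eq_sym (negPf kl) scaler0.
Qed.

End Components.

(** * The kernel of F - J and its traceless part *)

Section SharpEigenspace.
Context {C : numClosedFieldType} {d : nat} {I : finType}.
Variables (A : I -> 'M[C]_d) (w : C) (r : 'M[C]_d).
Hypotheses (Ap : is_povm A) (w0 : 0 <= w) (w1 : w <= 1) (rp : posdefmx r).
Hypothesis r1 : \tr r = 1.

Let Apsd j : possemidefmx (A j). Proof. exact: (proj1 Ap). Qed.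
Let Ah j : (A j)^t* = A j. Proof. exact/hermP/(proj1 (Apsd j)). Qed.
Let A1 : \sum_j A j = 1%:M. Proof. exact: (proj2 Ap). Qed.

Let F := calF r A.
Let K : 'M[C]_(d * d) := lin_mx (mixop w r).
Let J := invmx K.
Let Kp : posdefmx K. Proof. exact: mixop_posdef. Qed.
Let Jp : posdefmx J. Proof. exact: posdef_inv. Qed.
Let Ku : K \in unitmx. Proof. exact: posdef_unit. Qed.
Let Fh : F \is hermsymmx. Proof. exact: calF_herm. Qed.
Let JFp : possemidefmx (J - F). Proof. exact: calJ_sub_calF_psd. Qed.

(** The two relations give <<A_j|K Z>> = c_j p_j whatever w, so F K Z is the sum of the c_j A_j,
    which is Z. *)
Lemma mul_vec_mixop_calF Z (c : I -> C) :
  (forall j, Z *m A j = c j *: A j) -> (forall j, A j *m Z = c j *: A j) ->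
  mxvec Z *m (K *m F) = mxvec Z.
Proof.
move=> ZA AZ; rewrite mulmxA mul_vec_lin mul_vec_calF; congr mxvec.
rewrite -[RHS]mulmx1 -A1 mulmx_sumr; apply: eq_bigr => j _.
rewrite ZA; have [->|Aj0] := eqVneq (A j) 0; first by rewrite !scaler0.
congr (_ *: _); rewrite hsdot_mixop Ah AZ [\tr (_ *m Z)]mxtrace_mulC mulmxA ZA.
rewrite -!scalemxAl !mxtraceZ [\tr (A j *m r)]mxtrace_mulC.
rewrite -mulrDl addrC subrK mul1r mulfK// gt_eqF//.
exact: trace_povm_gt0.
Qed.

(** On row vectors [K *m F] is F after K. A fixed point Z has zero gap, so the equality case
    applies; conversely, P_k A_j = A_j P_k is A_j or 0. *)
Lemma ker_comp_mx : (kermx (K *m F - 1%:M) :=: comp_mx A)%MS.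
Proof.
apply/eqmxP/andP; split.
  apply/row_subP => i; set v := row i _.
  have : v *m (K *m F - 1%:M) = 0 by rewrite /v -row_mul mulmx_ker row0.
  rewrite -[v]vec_mxK; move: (vec_mx v) => Z ZK {v i}.
  have /(bessel_gap_eq0 Ap w0 w1 rp) [c [-> cc]] :
    hsdot Z (mixop w r Z) - \sum_j `|hsdot (A j) (mixop w r Z)| ^+ 2 /
      \tr (r *m A j) = 0.
    rewrite -(gap_form _ w0 w1 rp) -mul_vec_lin -/K -/J -/F.
    have -> : mxvec Z *m K *m (J - F) = 0.
      have -> : J - F = - (J *m (K *m F - 1%:M)).
        by rewrite mulmxBr mulKmx// mulmx1 opprB.
      by rewrite mulmxN mulmxA mulmxK// ZK oppr0.
    by rewrite mul0mx mxE.
  exact: sum_const_comp_mx.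
apply/row_subP => i; rewrite rowK; apply/sub_kermxP.
rewrite mulmxBr mulmx1; apply/eqP; rewrite subr_eq0; apply/eqP.
apply: (mul_vec_mixop_calF (c :=
   fun j => (fingraph.root (povm_adj A) j == enum_val i)%:R)).
  by move=> j; rewrite povm_comp_mulr//; case: ifP; rewrite ?scale1r ?scale0r.
by move=> j; rewrite povm_comp_mull//; case: ifP; rewrite ?scale1r ?scale0r.
Qed.

Lemma rank_ker_calF : \rank (kermx (F - J)) = proj_index A.
Proof.
rewrite -[RHS](eqP (comp_mx_free Ap)) -ker_comp_mx !mxrank_ker.
have -> : F - J = J *m (K *m F - 1%:M) by rewrite mulmxBr mulKmx// mulmx1.
by rewrite (eqmxMfull _ _)// row_full_unit unitmx_inv.
Qed.

(** Its row space is the orthogonal complement of the identity, because <<1|Y>> = tr Y. *)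
Definition traceless_mx : 'M[C]_(d * d) := kermx ((mxvec 1%:M)^t*).

Lemma sub_traceless Y : (mxvec Y <= traceless_mx)%MS = (\tr Y == 0).
Proof.
rewrite sub_kermx; apply/eqP/eqP => [/matrixP/(_ 0 0)|Y0].
  by rewrite mxvec_adj_dot mxE /hsdot adjmx_scalar rmorph1 mul1mx.
apply/matrixP => i j; rewrite !ord1 mxvec_adj_dot mxE.
by rewrite /hsdot adjmx_scalar rmorph1 mul1mx.
Qed.

(** The trace has rank 1 on the kernel: J rho = 1 and F rho is the sum of the A_j, so rho lies in
    the kernel, and tr rho = 1. *)
Lemma rank_ker_calF_traceless :
  (\rank (kermx (F - J) :&: traceless_mx)%MS).+1 = proj_index A.
Proof.
rewrite -rank_ker_calF -(mxrank_mul_ker (kermx (F - J)) ((mxvec 1%:M)^t*)) -add1n.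
congr (_ + _)%N; apply/eqP; rewrite eqn_leq rank_leq_col andbT lt0n mxrank_eq0.
have rE : mixop w r 1%:M = r.
  by rewrite /mixop mulmx1 mul1mx -scalerDl addrC subrK scale1r.
have rk : (mxvec r <= kermx (F - J))%MS.
  apply/sub_kermxP; rewrite mulmxBr -[in X in _ - X]rE -mul_vec_lin mulmxK//.
  rewrite mul_vec_calF; apply/eqP; rewrite subr_eq0; apply/eqP; congr mxvec.
  rewrite -A1; apply: eq_bigr => j _; rewrite /hsdot Ah mxtrace_mulC.
  have [->|Aj0] := eqVneq (A j) 0; first by rewrite scaler0.
  by rewrite divff ?scale1r// gt_eqF//; apply: trace_povm_gt0.
apply/negP => /eqP E0; have : mxvec r *m (mxvec 1%:M)^t* = 0.
  by have /submxP[D ->] := rk; rewrite -mulmxA E0 mulmx0.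
move/sub_kermxP; rewrite -/traceless_mx sub_traceless r1.
by rewrite oner_eq0.
Qed.

Lemma ker_calF_form (y : 'rV[C]_(d * d)) : y *m (F - J) *m y^t* = 0 ->
  (y <= kermx (F - J))%MS.
Proof.
move=> y0; apply/sub_kermxP; rewrite -[F - J]opprB mulmxN (psd_row_eq0 JFp) ?oppr0//.
by rewrite -[J - F]opprB mulmxN mulNmx y0 oppr0.
Qed.

Lemma mu_calF : mu (normalizedF J r A) = proj_index A.
Proof. by rewrite mu_normalized// rank_ker_calF. Qed.

(** The multiplicity is the dimension of the left kernel of B (F - J) B^*. If u lies in it, the form
    of F - J vanishes at u B, which is then in ker (F - J) by semidefiniteness. *)
Lemma mu_param_calF g (B : 'M[C]_(g, d * d)) : row_free B -> (B :=: traceless_mx)%MS ->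
  (mu (invsqrtmx (B *m J *m B^t*) *m (B *m F *m B^t*) *m
       invsqrtmx (B *m J *m B^t*))).+1 = proj_index A.
Proof.
move=> Bf BW; rewrite mu_normalized; first last.
- by apply/hermP; rewrite !adjmxM trmxCK; have /hermP -> := Fh; rewrite mulmxA.
- exact: posdef_congr.
rewrite -rank_ker_calF_traceless; congr S.
set N := kermx _; rewrite -(mxrankMfree N Bf); apply: eqmx_rank; apply/andP; split.
  rewrite sub_capmx -BW submxMl andbT; apply/row_subP => i; rewrite row_mul.
  apply: ker_calF_form; rewrite adjmxM.
  have := mulmx_ker (B *m F *m B^t* - B *m J *m B^t*); rewrite -/N => /(congr1 (row i)).
  rewrite row_mul row0 -mulmxBl -mulmxBr !mulmxA => ->.
  by rewrite mul0mx.
have : (kermx (F - J) :&: traceless_mx <= B)%MS by rewrite BW capmxSr.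
case/submxP => D DE; rewrite DE submxMr//; apply/sub_kermxP.
rewrite -mulmxBl -mulmxBr !mulmxA -DE.
by have /sub_kermxP -> := capmxSl (kermx (F - J)) traceless_mx; rewrite mul0mx.
Qed.

End SharpEigenspace.

(** * Compression by an orthogonal projector and the Moore-Penrose inverse *)

Section Compression.
Context {C : numClosedFieldType}.

Lemma is_mpinv_adj n (M P : 'M[C]_n) : is_mpinv M P -> is_mpinv (M^t*) (P^t*).
Proof.
move=> [MPM PMP MP PM]; split.
- by rewrite -!adjmxM mulmxA MPM.
- by rewrite -!adjmxM mulmxA PMP.
- by rewrite -adjmxM PM.
- by rewrite -adjmxM MP.
Qed.

(** Uniqueness makes the inverse N Hermitian, and then N = N M N is a congruence of M. *)
Lemma mpinv_psd n (M : 'M[C]_n) : possemidefmx M -> possemidefmx (mpinv M).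
Proof.
move=> Mp; have /hermP Mh := proj1 Mp; have MN := mpinvP (proj1 Mp).
have Nh : (mpinv M)^t* = mpinv M.
  by have MNh := is_mpinv_adj MN; rewrite Mh in MNh; apply: is_mpinv_uniq MNh MN.
have [_ <- _ _] := MN; rewrite -{1}Nh; exact: psd_congr.
Qed.

Variables (n : nat) (J F Q : 'M[C]_n).
Hypotheses (Jp : posdefmx J) (JFp : possemidefmx (J - F)).
Hypotheses (Qh : Q^t* = Q) (QQ : Q *m Q = Q).

Let JQ := Q *m J *m Q.
Let FQ := Q *m F *m Q.
Let N := mpinv JQ.
Let T := sqrtmx N.

Let JQp : possemidefmx JQ.
Proof. by have := psd_congr Q (posdef_psd Jp); rewrite Qh. Qed.
Let Np : possemidefmx N. Proof. exact: mpinv_psd. Qed.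
Let JQh : JQ^t* = JQ. Proof. exact/hermP/(proj1 JQp). Qed.
Let Nh : N^t* = N. Proof. exact/hermP/(proj1 Np). Qed.
Let Th : T^t* = T. Proof. exact/hermP/(proj1 (sqrtmx_psd Np)). Qed.
Let TT : T *m T = N. Proof. exact: sqrtmxK. Qed.
Let JQQ : JQ *m Q = JQ. Proof. by rewrite /JQ -mulmxA QQ. Qed.

Let Jform0 (v : 'rV[C]_n) : v *m J *m v^t* = 0 -> v = 0.
Proof.
move/(psd_row_eq0 (posdef_psd Jp)) => vJ.
by rewrite -(mulmxK (posdef_unit Jp) v) vJ mul0mx.
Qed.

(** The form of J vanishes at v Q, and J is definite. *)
Let JQ_ker (v : 'rV[C]_n) : v *m JQ = 0 -> v *m Q = 0.
Proof.
move=> vJ; apply: Jform0.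
by rewrite adjmxM Qh !mulmxA -(mulmxA v) -(mulmxA v) vJ mul0mx.
Qed.

Let JQNQ : JQ *m N *m Q = Q.
Proof.
have [JNJ _ _ _] := mpinvP (proj1 JQp).
apply/eqP; rewrite -subr_eq0; apply/eqP/row_matrixP => i; rewrite row0.
have -> : JQ *m N *m Q - Q = (JQ *m N - 1%:M) *m Q by rewrite mulmxBl mul1mx.
rewrite row_mul; apply: JQ_ker.
by rewrite -row_mul mulmxBl mul1mx JNJ subrr row0.
Qed.

Let NQ : N *m Q = N.
Proof.
have [_ NJN JNh _] := mpinvP (proj1 JQp); rewrite -/N in NJN JNh.
have cm : N *m JQ = JQ *m N by rewrite -JNh adjmxM Nh JQh.
rewrite -{1}NJN -(mulmxA N) -cm mulmxA -(mulmxA _ JQ) JQQ.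
by rewrite -mulmxA cm mulmxA.
Qed.

(** N inverts JQ on the range of Q; this is the adjoint of [JQNQ], simplified by [NQ]. *)
Let NJQ : N *m JQ = Q.
Proof.
rewrite -[RHS]Qh -[X in _ = X^t*]JQNQ (adjmxM _ Q) (adjmxM JQ) Qh Nh JQh mulmxA.
by rewrite -[Q *m N]trmxCK (adjmxM Q) Qh Nh NQ Nh.
Qed.

(** The squared norm of T - T Q involves T only through T T = N, and N Q = N. *)
Let TQ : T *m Q = T.
Proof.
clearbody T; apply/eqP; rewrite eq_sym -subr_eq0; apply/eqP/trace_adj_eq0.
rewrite adjmxB adjmxM Qh Th mulmxBl !mulmxBr !mulmxA TT NQ subrr.
by rewrite -[Q *m T *m T]mulmxA TT -[Q *m N *m Q]mulmxA NQ !subrr mxtrace0.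
Qed.

(** Right multiplication by T carries the eigenvectors onto the kernel part. For y = x T one gets y
    Q = y and y JQ = y FQ, so the form of J - F vanishes at y. *)
Lemma mu_compressed :
  F \is hermsymmx -> mu (T *m FQ *m T) = \rank (kermx (F - J) :&: Q)%MS.
Proof.
move=> /hermP Fh; have FQh : FQ^t* = FQ by rewrite !adjmxM Qh Fh mulmxA.
rewrite mu_herm; last first.
  by apply/hermP; rewrite (adjmxM _ T) (adjmxM T) Th FQh mulmxA.
have JQE : JQ = Q *m J *m Q by [].
have FQE : FQ = Q *m F *m Q by [].
clearbody T N JQ FQ; set X := kermx _.
have XE : X *m T *m FQ *m T = X.
  apply/eqP; rewrite -subr_eq0; have := mulmx_ker (T *m FQ *m T - 1%:M).
  by rewrite -/X mulmxBr mulmx1 !mulmxA => ->.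
(* T may be singular, but X = X T FQ T factors through X T, so no rank is lost. *)
have -> : \rank X = \rank (X *m T).
  apply/eqP; rewrite eqn_leq mxrankM_maxl andbT -{1}XE -(mulmxA (X *m T)).
  exact: mxrankM_maxl.
apply: eqmx_rank; apply/andP; split.
  have XQ : (X *m T <= Q)%MS by rewrite -TQ mulmxA submxMl.
  rewrite sub_capmx XQ andbT; apply/row_subP => i.
  apply/sub_kermxP; rewrite -[F - J]opprB mulmxN (psd_row_eq0 JFp) ?oppr0//.
  set y := row i _; have yQ : y *m Q = y by rewrite /y -row_mul -mulmxA TQ.
  have yE : y *m JQ = y *m FQ.
    rewrite /y -!row_mul; congr row.
    transitivity (X *m T *m FQ *m T *m T *m JQ); first by rewrite XE.
    rewrite -(mulmxA (X *m T *m FQ) T T) TT -(mulmxA _ N) NJQ -(mulmxA _ FQ Q).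
    by rewrite FQE -(mulmxA _ Q Q) QQ.
  rewrite -{1}yQ -{1}[in y^t*]yQ adjmxM Qh !mulmxA -(mulmxA y) -(mulmxA y).
  by rewrite mulmxBr mulmxBl -JQE -FQE mulmxBr yE subrr mul0mx.
set Y := (_ :&: _)%MS; have YQ : Y *m Q = Y.
  have /submxP[D ->] : (Y <= Q)%MS by exact: capmxSr.
  by rewrite -mulmxA QQ.
have YJ : Y *m F = Y *m J.
  have /sub_kermxP/eqP : (Y <= kermx (F - J))%MS by exact: capmxSl.
  by rewrite mulmxBr subr_eq0 => /eqP.
(* The preimage of Y under T is Y JQ T, since T T = N and JQ N = Q. *)
have YE : Y *m JQ *m T *m T = Y.
  have JQN : JQ *m N = Q by rewrite -[LHS]trmxCK (adjmxM JQ) JQh Nh NJQ Qh.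
  by rewrite -(mulmxA (Y *m JQ) T T) TT -(mulmxA Y JQ) JQN.
rewrite -[X in (X <= _)%MS]YE submxMr//; apply/sub_kermxP.
by rewrite mulmxBr mulmx1 !mulmxA YE FQE JQE !mulmxA YQ YJ subrr.
Qed.

End Compression.

(** * The projector onto traceless operators *)

Section CompressedFisher.
Context {C : numClosedFieldType} {d : nat}.
Implicit Types X Y : 'M[C]_d.

Definition traceless_part X : 'M[C]_d := X - (\tr X / d%:R)%:M.

Lemma traceless_part_linear : linear traceless_part.
Proof.
move=> a X Y; rewrite /traceless_part mxtraceD mxtraceZ mulrDl.
rewrite (raddfD (@scalar_mx C d)).
by rewrite scalerBr scale_scalar_mx mulrA opprD addrACA.
Qed.

HB.instance Definition _ :=
  GRing.isLinear.Build C 'M[C]_d 'M[C]_d *:%R traceless_part traceless_part_linear.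

Let IbarE : @Ibar C d = lin_mx traceless_part. Proof. by []. Qed.

Lemma Ibar_herm : (@Ibar C d)^t* = Ibar.
Proof.
rewrite IbarE; apply/hermP/lin_mx_herm => X Y.
rewrite /= /traceless_part /hsdot adjmxB mulmxBl mulmxBr !linearB/=.
rewrite mul_mx_scalar adjmx_scalar mul_scalar_mx !mxtraceZ mxtrace_adj.
by rewrite rmorphM/= fmorphV/= rmorph_nat mulrAC [in RHS]mulrAC (mulrC (\tr X)).
Qed.

Hypothesis d0 : (0 < d)%N.

Lemma mxtrace_traceless_part X : \tr (traceless_part X) = 0.
Proof.
rewrite /traceless_part linearB/= mxtrace_scalar -[X in _ - X]mulr_natr.
by rewrite divfK ?subrr// pnatr_eq0 -lt0n.
Qed.

Lemma Ibar_idem : @Ibar C d *m Ibar = Ibar.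
Proof.
rewrite IbarE; apply/row_matrixP => i; rewrite row_mul rowE !mul_rV_lin/= mxvecK.
rewrite /traceless_part; move: (mxtrace_traceless_part (vec_mx (delta_mx 0 i))).
by rewrite /traceless_part => ->; rewrite mul0r (raddf0 (@scalar_mx C d)) subr0.
Qed.

Lemma IbarE_traceless : (@Ibar C d :=: traceless_mx)%MS.
Proof.
apply/eqmxP/andP; split; apply/row_subP => i.
  by rewrite rowE IbarE mul_rV_lin sub_traceless mxtrace_traceless_part.
have : (row i (@traceless_mx C d) <= traceless_mx)%MS by exact: row_sub.
rewrite -[row i _]vec_mxK; move: (vec_mx _) => Y; rewrite sub_traceless => /eqP Y0.
apply/submxP; exists (mxvec Y); rewrite IbarE mul_vec_lin/= /traceless_part.
by rewrite Y0 mul0r (raddf0 (@scalar_mx C d)) subr0.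
Qed.

End CompressedFisher.

Lemma mu_calFbar (C : numClosedFieldType) d (I : finType) (A : I -> 'M[C]_d)
    (w : C) (r : 'M[C]_d) : is_povm A -> 0 <= w -> w <= 1 -> posdefmx r ->
  \tr r = 1 ->
  (mu (normalizedFbar (invmx (lin_mx (mixop w r))) r A)).+1 = proj_index A.
Proof.
move=> Ap w0 w1 rp r1; have d0 : (0 < d)%N.
  (* In dimension 0 the trace would be 0 and not 1; so the division by d in [Ibar] is meaningful. *)
  case: d A r Ap rp r1 => // A r _ _ /eqP.
  by rewrite /mxtrace big_ord0 eq_sym oner_eq0.
rewrite /normalizedFbar mu_compressed ?calF_herm//.
- rewrite -(rank_ker_calF_traceless Ap w0 w1 rp r1); congr S.
  by apply: eqmx_rank; apply/eqmxP; apply: cap_eqmx => //; apply: IbarE_traceless.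
- exact/posdef_inv/mixop_posdef.
- exact: calJ_sub_calF_psd.
- exact: Ibar_herm.
- exact: Ibar_idem.
Qed.

(** * Partial derivatives of complex-valued functions *)

Section ComplexDerivatives.
Context {R : realType} {g : nat}.
Local Notation C := R[i].
Implicit Types (f h : 'rV[R]_g -> C) (t : 'rV[R]_g) (a : 'I_g).

(** A relation that carries derivability with the value, so that the rules below compose;
    [cpartialE] returns to [cpartial]. *)
Definition is_cpartial f a t (D : C) : Prop :=
  is_derive t (delta_mx 0 a) (fun s => complex.Re (f s)) (complex.Re D) /\
  is_derive t (delta_mx 0 a) (fun s => complex.Im (f s)) (complex.Im D).

Lemma cdifferentiable_partial f a t :
  cdifferentiable f t -> is_cpartial f a t (cpartial f a t).
Proof.
by move=> [fr fi]; split; apply: derivableP; apply: diff_derivable.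
Qed.

Lemma cpartialE f a t D : is_cpartial f a t D -> cpartial f a t = D.
Proof.
by move=> [[_ fr] [_ fi]]; rewrite /cpartial fr fi; case: D {fr fi}.
Qed.

Lemma is_cpartial_cst c a t : is_cpartial (fun=> c) a t 0.
Proof. by split; apply: is_derive_cst. Qed.

Lemma is_cpartialD f h a t D E : is_cpartial f a t D -> is_cpartial h a t E ->
  is_cpartial (fun s => f s + h s) a t (D + E).
Proof.
move=> [fr fi] [hr hi]; split.
  have -> : (fun s => complex.Re (f s + h s)) =
      (fun s => complex.Re (f s)) \+ (fun s => complex.Re (h s)).
    by apply/funext => s /=; rewrite raddfD.
  by rewrite raddfD; apply: is_deriveD.
have -> : (fun s => complex.Im (f s + h s)) =
    (fun s => complex.Im (f s)) \+ (fun s => complex.Im (h s)).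
  by apply/funext => s /=; rewrite raddfD.
by rewrite raddfD; apply: is_deriveD.
Qed.

Lemma is_cpartialMr f c a t D : is_cpartial f a t D ->
  is_cpartial (fun s => f s * c) a t (D * c).
Proof.
case: c => x y [fr fi]; split.
  have -> : (fun s => complex.Re (f s * Complex x y)) =
      x \*: (fun s => complex.Re (f s)) - y \*: (fun s => complex.Im (f s)).
    apply/funext => s; transitivity (x * complex.Re (f s) - y * complex.Im (f s)) => //.
    by case: (f s) => u v /=; rewrite (mulrC u) (mulrC v).
  have -> : complex.Re (D * Complex x y) = x *: complex.Re D - y *: complex.Im D.
    by case: D {fr fi} => u v /=; rewrite (mulrC u) (mulrC v).
  by apply: is_deriveB.
have -> : (fun s => complex.Im (f s * Complex x y)) =
    y \*: (fun s => complex.Re (f s)) + x \*: (fun s => complex.Im (f s)).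
  apply/funext => s; transitivity (y * complex.Re (f s) + x * complex.Im (f s)) => //.
  by case: (f s) => u v /=; rewrite (mulrC u) (mulrC v) addrC.
have -> : complex.Im (D * Complex x y) = y *: complex.Re D + x *: complex.Im D.
  by case: D {fr fi} => u v /=; rewrite (mulrC u) (mulrC v) addrC.
by apply: is_deriveD.
Qed.

Lemma is_cpartial_conj f a t D : is_cpartial f a t D ->
  is_cpartial (fun s => (f s)^*) a t (D^*).
Proof.
move=> [fr fi]; split.
  have -> : (fun s => complex.Re (f s)^*) = (fun s => complex.Re (f s)).
    by apply/funext => s; case: (f s).
  by case: D fr {fi}.
have -> : (fun s => complex.Im (f s)^*) = - (fun s => complex.Im (f s)).
  apply/funext => s; transitivity (- complex.Im (f s)) => //.
  by case: (f s).
have -> : complex.Im D^* = - complex.Im D by case: D {fr fi}.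
exact: is_deriveN.
Qed.

Lemma is_cpartial_sum (T : Type) (s : seq T) (F : T -> 'rV[R]_g -> C) a t (D : T -> C) :
  (forall i, is_cpartial (F i) a t (D i)) ->
  is_cpartial (fun x => \sum_(i <- s) F i x) a t (\sum_(i <- s) D i).
Proof.
move=> FD; elim: s => [|i s IHs].
  by under eq_fun do rewrite big_nil; rewrite big_nil; apply: is_cpartial_cst.
under eq_fun do rewrite big_cons; rewrite big_cons; exact: is_cpartialD.
Qed.

(** Densities are given only on the open set [Theta], where trace 1 and hermiticity hold near the
    point; derivatives see no more than that. *)
Lemma near_is_cpartial f h a t D : (\forall s \near t, f s = h s) ->
  is_cpartial f a t D -> cpartial h a t = D.
Proof.
move=> fh /cpartialE <-; congr Complex; apply: near_eq_derive;
by apply: filterS fh => s ->.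
Qed.

Lemma is_cpartial_trace d (F : 'rV[R]_g -> 'M[C]_d) a t (B : 'M[C]_d) :
  (forall i j, cdifferentiable (fun s => F s i j) t) ->
  is_cpartial (fun s => \tr (F s *m B)) a t (\tr (mxpartial F a t *m B)).
Proof.
move=> Fd; apply: is_cpartial_sum => i; rewrite mxE.
have -> : (fun s => (F s *m B) i i) = (fun s => \sum_j F s i j * B j i).
  by apply/funext => s; rewrite mxE.
apply: is_cpartial_sum => j; apply: is_cpartialMr; rewrite mxE.
exact: cdifferentiable_partial.
Qed.

End ComplexDerivatives.

(** * Fisher matrices as Gram matrices in the basis of derivatives *)

Section FisherMatrices.
Context {R : realType} {d : nat} {I : finType}.
Local Notation C := R[i].
Local Notation g := (d ^ 2 - 1)%N.
Variables (Theta : set 'rV[R]_g) (rho : 'rV[R]_g -> 'M[C]_d) (t : 'rV[R]_g).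
Variable A : I -> 'M[C]_d.
Hypotheses (rhoP : is_parametrization Theta rho) (tT : Theta t) (Ap : is_povm A).

Let r := rho t.
Let D a : 'M[C]_d := mxpartial rho a t.
Let rp : posdefmx r. Proof. by have [_ /(_ _ tT)[[]]] := rhoP. Qed.
Let r1 : \tr r = 1. Proof. by have [_ /(_ _ tT)[[]]] := rhoP. Qed.
Let rdiff i j : cdifferentiable (fun s => rho s i j) t.
Proof. by have [_ /(_ _ tT)[]] := rhoP. Qed.

Let near_Theta : \forall s \near t, Theta s.
Proof. by have [To _] := rhoP; apply: open_nbhs_nbhs. Qed.

Let Dtr0 a : \tr (D a) = 0.
Proof.
have := is_cpartial_trace a 1%:M rdiff; rewrite mulmx1 => h.
rewrite -(cpartialE h); apply: (near_is_cpartial _ (is_cpartial_cst 1 a t)).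
apply: filterS near_Theta => s Ts; rewrite mulmx1.
by have [_ /(_ _ Ts)[[]]] := rhoP.
Qed.

Let Dh a : (D a)^t* = D a.
Proof.
apply/matrixP => i j; rewrite !mxE.
have h := cdifferentiable_partial a (rdiff j i).
apply/esym; apply: (near_is_cpartial _ (is_cpartial_conj h)).
apply: filterS near_Theta => s Ts.
have [_ /(_ _ Ts)[[[/hermP rh _] _] _ _]] := rhoP.
by rewrite -[in RHS]rh !mxE.
Qed.

Definition partial_mx : 'M[C]_(g, d * d) := \matrix_a mxvec (mxpartial rho a t).
Let B := partial_mx.

(** Independence is assumed over the reals. As the D_a are Hermitian, adding a complex relation to
    its adjoint gives a real one with coefficients 2 Re u_a. *)
Let Re_coord0 (u : 'rV[C]_g) : u *m B = 0 -> forall a, complex.Re (u 0 a) = 0.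
Proof.
rewrite mulmx_sum_row => /(congr1 vec_mx); rewrite linear0 linear_sum/=.
under eq_bigr do rewrite linearZ/= rowK mxvecK -/(D _).
move=> u0; have [_ /(_ _ tT)[_ _ lin]] := rhoP.
have := lin (fun a => complex.Re (u 0 a) *+ 2); rewrite -/(D _).
have -> : \sum_a (complex.Re (u 0 a) *+ 2)%:C%C *: mxpartial rho a t = 0.
  have /(congr1 (fun X => X^t*)) := u0; rewrite trmx0 map_mx0 adjmx_sum => u0'.
  transitivity (\sum_a u 0 a *: D a + \sum_a (u 0 a *: D a)^t*).
    rewrite -big_split/=; apply: eq_bigr => a _.
    rewrite adjmxZ Dh -scalerDl; congr (_ *: _).
    case: (u 0 a) => x y; transitivity (Complex (x + x) (y - y)) => //.
    by rewrite subrr -mulr2n.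
  by rewrite u0' u0 addr0.
by move=> /(_ erefl) h a; have /eqP := h a; rewrite mulrn_eq0/= => /eqP.
Qed.

Let B_free : row_free B.
Proof.
apply: inj_row_free => u u0; apply/rowP => a; rewrite mxE.
have ure := Re_coord0 u0 a.
(* The real parts for i u are minus the imaginary parts for u. *)
have := Re_coord0 (u := 'i%C *: u); rewrite -scalemxAl u0 scaler0.
move=> /(_ erefl a); rewrite mxE; case: (u 0 a) ure => x y /= -> ; simpc.
by rewrite /= ?mul0r ?mul1r ?sub0r => /eqP; rewrite oppr_eq0 => /eqP ->.
Qed.

(** A dimension count: d^2 - 1 independent rows inside a hyperplane. *)
Let B_traceless : (B :=: traceless_mx)%MS.
Proof.
have sB : (B <= traceless_mx)%MS.
  by apply/row_subP => a; rewrite rowK sub_traceless Dtr0.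
apply/eqmxP; rewrite sB/= -(mxrank_leqif_sup sB) (eqP B_free) mxrank_ker.
suff -> : \rank ((mxvec (1%:M : 'M[C]_d))^t*) = 1%N by rewrite mulnn.
apply/eqP; rewrite eqn_leq rank_leq_col lt0n mxrank_eq0.
apply/eqP => /(congr1 (mulmx (mxvec r)))/matrixP/(_ 0 0).
rewrite mulmx0 mxvec_adj_dot mxE /hsdot adjmx_scalar rmorph1 mul1mx r1 => /eqP.
by rewrite oner_eq0.
Qed.

Let BM_entry (M : 'M[C]_(d * d)) a b :
  (B *m M *m B^t*) a b = (mxvec (D a) *m M *m (mxvec (D b))^t*) 0 0.
Proof.
transitivity (row a (B *m M *m B^t*) 0 b); first by rewrite [RHS]mxE.
rewrite !row_mul rowK !mxE; apply: eq_bigr => k _.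
by rewrite !mxE.
Qed.

Lemma fisherE : fisher rho t A = B *m calF r A *m B^t*.
Proof.
apply/matrixP => a b; rewrite BM_entry mul_vec_calF mxvec_adj_dot mxE.
rewrite /hsdot Dh mulmx_sumr raddf_sum/= [RHS](bigID (fun j => A j != 0))/=.
rewrite [X in _ = _ + X]big1 ?addr0; last first.
  by move=> j; rewrite negbK => /eqP ->; rewrite scaler0 mulmx0 mxtrace0.
apply: eq_bigr => j _; have Ah : (A j)^t* = A j by apply/hermP; have [[]] := proj1 Ap j.
rewrite !(cpartialE (is_cpartial_trace _ (A j) rdiff)).
rewrite -scalemxAr mxtraceZ Ah (mxtrace_mulC (A j)) /prob -/(D a) -/(D b) -/r.
by rewrite [_^-1 * _]mulrC.
Qed.

Let J_entry w (X Z : 'M[C]_d) : 0 <= w -> w <= 1 -> mixop w r Z = X ->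
  mxvec X *m invmx (lin_mx (mixop w r)) = mxvec Z.
Proof.
move=> w0 w1 <-; rewrite -mul_vec_lin mulmxK//.
exact/posdef_unit/mixop_posdef.
Qed.

(** The symmetric logarithmic derivative of D_a is its preimage under [mixop 2^-1 r], that is, J
    D_a. *)
Lemma J_SE : J_S rho t = B *m calJ_S r *m B^t*.
Proof.
apply/matrixP => a b; rewrite BM_entry /calJ_S calSE mxE.
have w1 : 2^-1 <= 1 :> C by rewrite invf_le1 ?ler1n// ltr0n.
have Dherm c : D c \is hermsymmx by apply/hermP.
rewrite -/r -/(D a) -/(D b).
have [_ +] := sldP rp (Dherm a); have [_ +] := sldP rp (Dherm b).
move: (sld r (D a)) (sld r (D b)) => La Lb LbE LaE.
have mixL : mixop 2^-1 r La = D a by rewrite /mixop subr_half -scalerDr.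
rewrite (J_entry _ w1 mixL) ?invr_ge0 ?ler0n// mxvec_adj_dot /hsdot Dh -LbE.
rewrite -scalemxAl mxtraceZ; congr (_ * _).
rewrite mulmxDr mulmxDl !mxtraceD addrC !mulmxA; congr (_ + _).
by rewrite mxtrace_mulC mulmxA.
Qed.

(** The entry (a, b) of B J B^* is <<D_b|J D_a>>, the transpose of the usual Gram matrix; hence
    [calJ_R] appears here, whereas <<D_a|J D_b>> would call for [calJ_L]. *)
Lemma J_RE : J_R rho t = B *m calJ_R r *m B^t*.
Proof.
apply/matrixP => a b; rewrite BM_entry /calJ_R calRE mxE.
rewrite (J_entry (Z := D a *m invmx r)) ?ler01//; last first.
  by rewrite /mixop scale0r add0r subr0 scale1r mulmxKV// posdef_unit.
by rewrite mxvec_adj_dot /hsdot Dh -/r -/(D a) -/(D b) mxtrace_mulC.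
Qed.

Lemma J_LE : J_L rho t = B *m calJ_L r *m B^t*.
Proof.
apply/matrixP => a b; rewrite BM_entry /calJ_L calLE mxE.
rewrite (J_entry (Z := invmx r *m D a)) ?ler01//; last first.
  by rewrite /mixop subrr scale0r addr0 scale1r mulKVmx// posdef_unit.
by rewrite mxvec_adj_dot /hsdot Dh -/r -/(D a) -/(D b) -mulmxA mxtrace_mulC -mulmxA.
Qed.

Lemma mu_normalizedI w : 0 <= w -> w <= 1 ->
  (mu (normalizedI (B *m invmx (lin_mx (mixop w r)) *m B^t*) rho t A)).+1 =
  proj_index A.
Proof.
by move=> w0 w1; rewrite /normalizedI fisherE; apply: mu_param_calF.
Qed.

End FisherMatrices.

(** * The multiplicities for the weights 1/2, 1 and 0 *)

Theorem theorem3 (R : realType) (d : nat)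
  (Theta : set 'rV[R]_(d ^ 2 - 1)) (rho : 'rV[R]_(d ^ 2 - 1) -> 'M[R[i]]_d)
  (theta : 'rV[R]_(d ^ 2 - 1)) (I : finType) (A : I -> 'M[R[i]]_d) :
  is_parametrization Theta rho -> Theta theta -> is_povm A ->
  [/\ [/\ mu (calF_S (rho theta) A) = proj_index A,
          sharpness rho theta A = mu (I_S rho theta A),
          mu (I_S rho theta A) = mu (calFbar_S (rho theta) A) &
          (mu (calFbar_S (rho theta) A))%:Z = (proj_index A)%:Z - 1],
      [/\ mu (calF_L (rho theta) A) = proj_index A,
          sharpness rho theta A = mu (I_R rho theta A),
          mu (I_R rho theta A) = mu (calFbar_L (rho theta) A) &
          (mu (calFbar_L (rho theta) A))%:Z = (proj_index A)%:Z - 1] &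
      [/\ mu (calF_R (rho theta) A) = proj_index A,
          sharpness rho theta A = mu (I_L rho theta A),
          mu (I_L rho theta A) = mu (calFbar_R (rho theta) A) &
          (mu (calFbar_R (rho theta) A))%:Z = (proj_index A)%:Z - 1]].
Proof.
move=> rhoP tT Ap; have [rp r1] : is_density (rho theta).
  by have [_ /(_ _ tT)[]] := rhoP.
have [h0 h1] : 0 <= 2^-1 :> R[i] /\ 2^-1 <= 1 :> R[i].
  by rewrite invr_ge0 ler0n invf_le1 ?ler1n// ltr0n.
rewrite /sharpness /calF_S /calF_L /calF_R /calFbar_S /calFbar_L /calFbar_R.
rewrite /I_S /I_L /I_R (J_SE rhoP tT) (J_RE rhoP tT) (J_LE rhoP tT).
rewrite /calJ_S /calJ_L /calJ_R calSE calLE calRE.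
(* The successor form, free of truncated subtraction, is moved to the integers. *)
have succE (m n : nat) : m.+1 = n -> m%:Z = n%:Z - 1.
  by move=> <-; rewrite -addn1 PoszD addrK.
have eqS (l m n : nat) : l.+1 = n -> m.+1 = n -> l = m by move=> <- [].
have IE w (w0 : 0 <= w) (w1 : w <= 1) := mu_normalizedI rhoP tT Ap w0 w1.
have FbE w (w0 : 0 <= w) (w1 : w <= 1) := mu_calFbar Ap w0 w1 rp r1.
have FE w (w0 : 0 <= w) (w1 : w <= 1) := mu_calF Ap w0 w1 rp.
(* All these multiplicities have successor [proj_index A], so I_R can be matched with the barred
   F_L, and I_L with the barred F_R, despite their different weights. *)
have IS := IE _ h0 h1; have IR := IE _ (lexx 0) ler01; have IL := IE _ ler01 (lexx 1).
have FbS := FbE _ h0 h1; have FbL := FbE _ ler01 (lexx 1).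
have FbR := FbE _ (lexx 0) ler01.
split; split.
- exact: FE.
- by [].
- exact: eqS IS FbS.
- exact: succE FbS.
- exact: FE.
- exact: eqS IS IR.
- exact: eqS IR FbL.
- exact: succE FbL.
- exact: FE.
- exact: eqS IS IL.
- exact: eqS IL FbR.
- exact: succE FbR.
Qed.
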